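(* Let $(\mathcal M,g,A)$ be a Weyl geometry on a 4-dimensional real oriented manifold, with twistor bundles $\mathcal P$ and $\mathcal P'$. (a) $(\mathcal M,g,A)$ is anti-self-dual if and only if the forms $(F,B,E)$ form a closed differential ideal on $\mathcal P$, i.e. if and only if on $\mathcal P$ $$dF\wedge E\wedge F\wedge B=0,\quad dB\wedge E\wedge F\wedge B=0,\quad dE\wedge E\wedge F\wedge B=0.$$ (b) $(\mathcal M,g,A)$ is self-dual if and only if on $\mathcal P'$ $$dF'\wedge E'\wedge F'\wedge B'=0,\quad dB'\wedge E'\wedge F'\wedge B'=0,\quad dE'\wedge E'\wedge F'\wedge B'=0.$$
   Context: Weyl geometry. A metric on $\mathcal M$ is a nondegenerate symmetric bilinear complex-valued form. A Weyl geometry $(g,A)$ consists of a metric $g$ and a complex-valued 1-form $A$. In a coframe $(\theta^i)$ of complex-valued 1-forms, $g=g_{ij}\theta^i\theta^j$, the Weyl connection 1-forms $\Gamma^i_{\ j}$ are uniquely determined by $dg_{ij}-g_{ik}\Gamma^k_{\ j}-g_{jk}\Gamma^k_{\ i}=-A\,g_{ij}$ and $d\theta^i=-\Gamma^i_{\ j}\wedge\theta^j$. Let $w_{ijkl}$ be the Weyl tensor of the Levi-Civita connection of $g$ and $w_{ij}=\frac12w_{ijkl}\theta^k\wedge\theta^l$. A null cotetrad is a coframe $(\theta^1,\dots,\theta^4)=(M,P,N,K)$ with $g=MP-NK$, where $\alpha\beta=\frac12(\alpha\otimes\beta+\beta\otimes\alpha)$, and compatible with the orientation in the sense that the volume form is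 $\eta=M\wedge P\wedge N\wedge K$. The dual frame is $(m,p,n,k)$. Self-dual 2-forms are spanned by $P\wedge K,\ N\wedge K-M\wedge P,\ N\wedge M$; anti-self-dual ones by $M\wedge K,\ N\wedge K+M\wedge P,\ N\wedge P$. $(g,A)$ is anti-self-dual (self-dual) if all 2-forms $w_{ij}$ are anti-self-dual (self-dual) on $\mathcal M$. Twistor bundles. Totally null 2-planes of $T_x\mathcal M^{\mathbb C}$ form two disjoint 2-spheres: self-dual ones $s=\mathrm{Span}\{zm-k,zn-p\}$ and anti-self-dual ones $s'=\mathrm{Span}\{z'p-k,z'n-m\}$, with $z,z'\in\mathbb C\cup\{\infty\}$. $\mathcal P$ (resp. $\mathcal P'$) is the $S^2$-bundle over $\mathcal M$ (real dimension 6) of all self-dual (resp. anti-self-dual) such planes, with local coordinates $(x,z,\bar z)$ (resp. $(x,z',\bar z')$). On $\mathcal P$ (pullbacks not written) $$E=dz-\Gamma^3_{\ 2}+z(\Gamma^1_{\ 1}-\Gamma^4_{\ 4})+z^2\Gamma^2_{\ 3},\quad F=M+zK,\quad B=N+zP;$$ on $\mathcal P'$ $$E'=dz'-\Gamma^3_{\ 1}+z'(\Gamma^2_{\ 2}-\Gamma^4_{\ 4})+z'^2\Gamma^1_{\ 3},\quad F'=P+z'K,\quad B'=N+z'M.$$ Intrinsically $E$ (and $E'$) is defined up to multiplication by a nonvanishing function and $(F,B)$ (and $(F',B')$) up to an invertible linear substitution with function coefficients; the systems of equations do not depend on these choices. Standing assumption: $\mathcal M$ is such that $E,E'$ can be chosen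 globally (e.g. an open subset of $\mathbb R^4$). 1-forms $(A_1,\dots,A_s)$ form a closed differential ideal iff $dA_a\wedge A_1\wedge\dots\wedge A_s=0$ for all $a$. *)

(* Defs.v *)
From mathcomp Require Import all_boot all_order all_algebra.
From mathcomp Require Import all_classical all_reals all_analysis.
From mathcomp Require Export complex.

Set Implicit Arguments.
Unset Strict Implicit.
Unset Printing Implicit Defensive.

Import Order.TTheory GRing.Theory Num.Theory.
Import numFieldNormedType.Exports.

Local Open Scope classical_set_scope.
Local Open Scope complex_scope.
Local Open Scope ring_scope.

Fixpoint Ck (R : realType) (n k : nat) (V : set 'rV[R]_n) (f : 'rV[R]_n -> R)
    : Prop :=
  (forall u, V u -> {for u, continuous f}) /\
  (if k is k'.+1 then
     forall a : 'I_n,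
       (forall u, V u -> derivable f u (delta_mx 0 a)) /\
       Ck k' V ('D_(delta_mx 0 a) f)
   else True).

Definition smooth (R : realType) (n : nat) (V : set 'rV[R]_n)
    (f : 'rV[R]_n -> R) : Prop := forall k, Ck k V f.

Definition csmooth (R : realType) (n : nat) (V : set 'rV[R]_n)
    (f : 'rV[R]_n -> R[i]) : Prop :=
  smooth V (fun u => complex.Re (f u)) /\ smooth V (fun u => complex.Im (f u)).

Definition csmooth_mx (R : realType) (n p q : nat) (V : set 'rV[R]_n)
    (f : 'rV[R]_n -> 'M[R[i]]_(p, q)) : Prop :=
  forall i j, csmooth V (fun u => f u i j).

Definition cpartial (R : realType) (n : nat) (a : 'I_n)
    (f : 'rV[R]_n -> R[i]) (u : 'rV[R]_n) : R[i] :=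
  'D_(delta_mx 0 a) (fun v => complex.Re (f v)) u +i*
  'D_(delta_mx 0 a) (fun v => complex.Im (f v)) u.

(* A complex 1-form is a function 'rV[R]_n -> 'rV[R[i]]_n giving its          *)
(* components on dx^0, ..., dx^(n-1).  The value of a k-form at a point is    *)
(* the function of its components w(d_(I 0), ..., d_(I (k-1))).               *)
Definition kform (R : realType) (n k : nat) := ('I_k -> 'I_n) -> R[i].

Definition of_covector (R : realType) (n : nat) (b : 'rV[R[i]]_n)
    : kform R n 1 :=
  fun I => b 0 (I ord0).

(* Exterior product of a k-form and a covector, normalised so that            *)
(* (a /\ b)(v, w) = a(v) b(w) - a(w) b(v) for covectors a and b.              *)
Definition wedge (R : realType) (n k : nat) (w : kform R n k) (b : 'rV[R[i]]_n)
    : kform R n k.+1 :=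
  fun I => \sum_(i < k.+1)
    (-1) ^+ (k - i) * w (fun j => I (lift i j)) * b 0 (I i).

Definition wedge11 (R : realType) (n : nat) (a b : 'rV[R[i]]_n) : kform R n 2 :=
  wedge (of_covector a) b.

Definition d0 (R : realType) (n : nat) (f : 'rV[R]_n -> R[i]) (u : 'rV[R]_n)
    : 'rV[R[i]]_n :=
  \row_a cpartial a f u.

Definition d1 (R : realType) (n : nat) (w : 'rV[R]_n -> 'rV[R[i]]_n)
    (u : 'rV[R]_n) : kform R n 2 :=
  fun I => cpartial (I 0) (fun v => w v 0 (I 1)) u
         - cpartial (I 1) (fun v => w v 0 (I 0)) u.

Definition closed_ideal3 (R : realType) (n : nat) (Y : set 'rV[R]_n)
    (E F B : 'rV[R]_n -> 'rV[R[i]]_n) : Prop :=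
  forall y, Y y ->
    [/\ wedge (wedge (wedge (d1 F y) (E y)) (F y)) (B y) = (fun=> 0),
        wedge (wedge (wedge (d1 B y) (E y)) (F y)) (B y) = (fun=> 0)
      & wedge (wedge (wedge (d1 E y) (E y)) (F y)) (B y) = (fun=> 0)].

Record oriented_manifold4 (R : realType) := OrientedManifold4 {
  carrier :> topologicalType;
  carrier_hausdorff : hausdorff_space carrier;
  carrier_second_countable : @second_countable carrier;
  chart : Type;
  dom : chart -> set carrier;
  coord : chart -> carrier -> 'rV[R]_4;
  param : chart -> 'rV[R]_4 -> carrier;
  dom_cover : forall x : carrier, exists c, dom c x;
  dom_open : forall c, open (dom c);
  im_open : forall c, open (coord c @` dom c);
  coordK : forall c x, dom c x -> param c (coord c x) = x;
  coord_continuous : forall c, {within dom c, continuous (coord c)};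
  param_continuous :
    forall c, {within coord c @` dom c, continuous (param c)};
  transition_smooth : forall (c d : chart) (i : 'I_4),
    smooth (coord c @` (dom c `&` dom d))
           (fun u => coord d (param c u) 0 i);
  transition_oriented : forall (c d : chart) (u : 'rV[R]_4),
    (coord c @` (dom c `&` dom d)) u ->
    0 < \det ('J (coord d \o param c) u)
}.

Definition im (R : realType) (X : oriented_manifold4 R) (c : chart X)
    : set 'rV[R]_4 := coord c @` dom c.

Definition overlap (R : realType) (X : oriented_manifold4 R) (c d : chart X)
    : set 'rV[R]_4 := coord c @` (dom c `&` dom d).

Definition transition (R : realType) (X : oriented_manifold4 R) (c d : chart X)
    : 'rV[R]_4 -> 'rV[R]_4 := coord d \o param c.

(* Complexified Jacobian.  The library's convention is
   'D_v f u = v *m 'J f u, i.e. row a holds the partial derivatives along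
   the a-th coordinate. *)
Definition cjacobian (R : realType) (f : 'rV[R]_4 -> 'rV[R]_4) (u : 'rV[R]_4)
    : 'M[R[i]]_4 :=
  map_mx (fun r : R => r%:C) ('J f u).

(* Tensor fields on X are given by their components in all charts.
   A complex metric has no preferred square root of det g, so the volume form
   eta is part of the data, as vol c dx^0 /\ dx^1 /\ dx^2 /\ dx^3.  If
   g = M P - N K and eta = M /\ P /\ N /\ K, and T is the matrix of the
   coframe, then vol = det T and det g = (det T)^2 / 16, whence vol_norm. *)
Record weyl_geometry (R : realType) (X : oriented_manifold4 R) :=
  WeylGeometry {
  metric : chart X -> 'rV[R]_4 -> 'M[R[i]]_4;
  weyl_form : chart X -> 'rV[R]_4 -> 'rV[R[i]]_4;
  vol : chart X -> 'rV[R]_4 -> R[i];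
  metric_smooth : forall c, csmooth_mx (im c) (metric c);
  weyl_form_smooth : forall c, csmooth_mx (im c) (weyl_form c);
  vol_smooth : forall c, csmooth (im c) (vol c);
  metric_change : forall c d u, overlap c d u ->
    metric c u = cjacobian (transition c d) u *m metric d (transition c d u)
                 *m (cjacobian (transition c d) u)^T;
  weyl_form_change : forall c d u, overlap c d u ->
    weyl_form c u =
    weyl_form d (transition c d u) *m (cjacobian (transition c d) u)^T;
  vol_change : forall c d u, overlap c d u ->
    vol c u = vol d (transition c d u) * \det (cjacobian (transition c d) u);
  metric_sym : forall c u, im c u -> (metric c u)^T = metric c u;
  metric_nondeg : forall c u, im c u -> \det (metric c u) != 0;
  vol_norm : forall c u, im c u -> vol c u ^+ 2 = 16%:R * \det (metric c u)
}.

(* Frame indices start at 1, so that Gam i3 i2 is Gamma^3_2. *)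
Definition i1 : 'I_4 := @Ordinal 4 0 isT.
Definition i2 : 'I_4 := @Ordinal 4 1 isT.
Definition i3 : 'I_4 := @Ordinal 4 2 isT.
Definition i4 : 'I_4 := @Ordinal 4 3 isT.

(* A coframe on an open set of R^4 is a field th of matrices, row i of th u
   being the covector theta^i at u.  A system of connection 1-forms Gamma^i_j
   is a field Gam i j of covectors. *)

(* theta^1, ..., theta^4 = M, P, N, K with g = M P - N K, where
   a b = (a (x) b + b (x) a) / 2. *)
Definition null_gram (R : realType) : 'M[R[i]]_4 :=
  2^-1 *: (delta_mx i1 i2 + delta_mx i2 i1)
  - 2^-1 *: (delta_mx i3 i4 + delta_mx i4 i3).

(* M /\ P /\ N /\ K = \det (th u) dx^0 /\ dx^1 /\ dx^2 /\ dx^3 *)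
Definition null_cotetrad (R : realType) (X : oriented_manifold4 R)
    (G : weyl_geometry X) (c : chart X) (V : set 'rV[R]_4)
    (th : 'rV[R]_4 -> 'M[R[i]]_4) : Prop :=
  [/\ open V, V `<=` im c, csmooth_mx V th
    & forall u, V u ->
        metric G c u = (th u)^T *m null_gram R *m th u /\
        vol G c u = \det (th u)].

(* h u is the Gram matrix (g_ij) of the coframe. *)
Definition weyl_connection (R : realType) (V : set 'rV[R]_4)
    (h : 'rV[R]_4 -> 'M[R[i]]_4) (A : 'rV[R]_4 -> 'rV[R[i]]_4)
    (th : 'rV[R]_4 -> 'M[R[i]]_4)
    (Gam : 'I_4 -> 'I_4 -> 'rV[R]_4 -> 'rV[R[i]]_4) : Prop :=
  [/\ forall i j, csmooth_mx V (Gam i j),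
      forall u i j, V u ->
        d0 (fun v => h v i j) u
        - \sum_k h u i k *: Gam k j u - \sum_k h u j k *: Gam k i u
        = - (h u i j *: A u)
    & forall u i I, V u ->
        d1 (fun v => row i (th v)) u I
        = - \sum_j wedge11 (Gam i j u) (row j (th u)) I].

Definition levi_civita (R : realType) (V : set 'rV[R]_4)
    (h : 'rV[R]_4 -> 'M[R[i]]_4) (th : 'rV[R]_4 -> 'M[R[i]]_4)
    (Gam : 'I_4 -> 'I_4 -> 'rV[R]_4 -> 'rV[R[i]]_4) : Prop :=
  weyl_connection V h (fun=> 0) th Gam.

Definition curvature_form (R : realType)
    (Gam : 'I_4 -> 'I_4 -> 'rV[R]_4 -> 'rV[R[i]]_4) (i j : 'I_4)
    (u : 'rV[R]_4) : kform R 4 2 :=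
  fun I => d1 (Gam i j) u I + \sum_k wedge11 (Gam i k u) (Gam k j u) I.

(* R^i_(jkl), the value of the curvature form on the vectors e_k, e_l of the
   dual frame; the components of e_k are column k of invmx (th u). *)
Definition riemann_up (R : realType) (th : 'rV[R]_4 -> 'M[R[i]]_4)
    (Gam : 'I_4 -> 'I_4 -> 'rV[R]_4 -> 'rV[R[i]]_4) (u : 'rV[R]_4)
    (i j k l : 'I_4) : R[i] :=
  \sum_a \sum_b
    curvature_form Gam i j u (fun t : 'I_2 => if t == 0 then a else b)
    * invmx (th u) a k * invmx (th u) b l.

Definition riemann (R : realType) (h th : 'rV[R]_4 -> 'M[R[i]]_4)
    (Gam : 'I_4 -> 'I_4 -> 'rV[R]_4 -> 'rV[R[i]]_4) (u : 'rV[R]_4)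
    (i j k l : 'I_4) : R[i] :=
  \sum_m h u i m * riemann_up th Gam u m j k l.

Definition ricci (R : realType) (th : 'rV[R]_4 -> 'M[R[i]]_4)
    (Gam : 'I_4 -> 'I_4 -> 'rV[R]_4 -> 'rV[R[i]]_4) (u : 'rV[R]_4)
    (j l : 'I_4) : R[i] :=
  \sum_k riemann_up th Gam u k j k l.

Definition scalar_curvature (R : realType) (h th : 'rV[R]_4 -> 'M[R[i]]_4)
    (Gam : 'I_4 -> 'I_4 -> 'rV[R]_4 -> 'rV[R[i]]_4) (u : 'rV[R]_4) : R[i] :=
  \sum_j \sum_l invmx (h u) j l * ricci th Gam u j l.

Definition weyl_tensor (R : realType) (h th : 'rV[R]_4 -> 'M[R[i]]_4)
    (Gam : 'I_4 -> 'I_4 -> 'rV[R]_4 -> 'rV[R[i]]_4) (u : 'rV[R]_4)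
    (i j k l : 'I_4) : R[i] :=
  let Ric := ricci th Gam u in
  riemann h th Gam u i j k l
  - 2^-1 * (h u i k * Ric j l - h u i l * Ric j k
            - h u j k * Ric i l + h u j l * Ric i k)
  + scalar_curvature h th Gam u / 6%:R
    * (h u i k * h u j l - h u i l * h u j k).

Definition weyl_2form (R : realType) (h th : 'rV[R]_4 -> 'M[R[i]]_4)
    (Gam : 'I_4 -> 'I_4 -> 'rV[R]_4 -> 'rV[R[i]]_4) (u : 'rV[R]_4)
    (i j : 'I_4) : kform R 4 2 :=
  fun I => 2^-1 * \sum_k \sum_l
    weyl_tensor h th Gam u i j k l * wedge11 (row k (th u)) (row l (th u)) I.

(* T is the value of a null cotetrad (M, P, N, K) at a point. *)
Definition sd_2form (R : realType) (T : 'M[R[i]]_4) (w : kform R 4 2) : Prop :=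
  let M := row i1 T in let P := row i2 T in
  let N := row i3 T in let K := row i4 T in
  exists a b c : R[i], forall I,
    w I = a * wedge11 P K I + b * (wedge11 N K I - wedge11 M P I)
          + c * wedge11 N M I.

Definition asd_2form (R : realType) (T : 'M[R[i]]_4) (w : kform R 4 2) : Prop :=
  let M := row i1 T in let P := row i2 T in
  let N := row i3 T in let K := row i4 T in
  exists a b c : R[i], forall I,
    w I = a * wedge11 M K I + b * (wedge11 N K I + wedge11 M P I)
          + c * wedge11 N P I.

Definition self_dual (R : realType) (X : oriented_manifold4 R)
    (G : weyl_geometry X) : Prop :=
  forall c V th Gam, null_cotetrad G c V th ->
    levi_civita V (fun=> null_gram R) th Gam ->
    forall u i j, V u ->
      sd_2form (th u) (weyl_2form (fun=> null_gram R) th Gam u i j).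

Definition anti_self_dual (R : realType) (X : oriented_manifold4 R)
    (G : weyl_geometry X) : Prop :=
  forall c V th Gam, null_cotetrad G c V th ->
    levi_civita V (fun=> null_gram R) th Gam ->
    forall u i j, V u ->
      asd_2form (th u) (weyl_2form (fun=> null_gram R) th Gam u i j).

(* A null cotetrad over V identifies V x C with an open set of the bundle of
   self-dual null planes, (u, z) being the plane Span{z m - k, z n - p} at u;
   V x C is seen in R^(4+2) through the coordinates (x, Re z, Im z).  These
   patches, for all null cotetrads, cover the whole bundle, including the
   points z = oo: (K, -N, P, -M) is again a null cotetrad with the same volume
   form, and its fibre coordinate is -1/z.  Likewise for the anti-self-dual
   planes Span{z p - k, z n - m}, with (-N, K, M, -P). *)
Definition patch (R : realType) (V : set 'rV[R]_4) : set 'rV[R]_(4 + 2) :=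
  [set y | V (lsubmx y)].

Definition fibre_coord (R : realType) (y : 'rV[R]_(4 + 2)) : R[i] :=
  rsubmx y 0 0 +i* rsubmx y 0 1.

Definition pullback (R : realType) (w : 'rV[R]_4 -> 'rV[R[i]]_4)
    (y : 'rV[R]_(4 + 2)) : 'rV[R[i]]_(4 + 2) :=
  row_mx (w (lsubmx y)) 0.

Definition dfibre (R : realType) (y : 'rV[R]_(4 + 2)) : 'rV[R[i]]_(4 + 2) :=
  d0 (@fibre_coord R) y.

Definition twistor_E (R : realType)
    (Gam : 'I_4 -> 'I_4 -> 'rV[R]_4 -> 'rV[R[i]]_4) (y : 'rV[R]_(4 + 2))
    : 'rV[R[i]]_(4 + 2) :=
  let z := fibre_coord y in
  dfibre y - pullback (Gam i3 i2) y
  + z *: (pullback (Gam i1 i1) y - pullback (Gam i4 i4) y)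
  + z ^+ 2 *: pullback (Gam i2 i3) y.

Definition twistor_F (R : realType) (th : 'rV[R]_4 -> 'M[R[i]]_4)
    (y : 'rV[R]_(4 + 2)) : 'rV[R[i]]_(4 + 2) :=
  pullback (fun u => row i1 (th u)) y
  + fibre_coord y *: pullback (fun u => row i4 (th u)) y.

Definition twistor_B (R : realType) (th : 'rV[R]_4 -> 'M[R[i]]_4)
    (y : 'rV[R]_(4 + 2)) : 'rV[R[i]]_(4 + 2) :=
  pullback (fun u => row i3 (th u)) y
  + fibre_coord y *: pullback (fun u => row i2 (th u)) y.

Definition twistor_E' (R : realType)
    (Gam : 'I_4 -> 'I_4 -> 'rV[R]_4 -> 'rV[R[i]]_4) (y : 'rV[R]_(4 + 2))
    : 'rV[R[i]]_(4 + 2) :=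
  let z := fibre_coord y in
  dfibre y - pullback (Gam i3 i1) y
  + z *: (pullback (Gam i2 i2) y - pullback (Gam i4 i4) y)
  + z ^+ 2 *: pullback (Gam i1 i3) y.

Definition twistor_F' (R : realType) (th : 'rV[R]_4 -> 'M[R[i]]_4)
    (y : 'rV[R]_(4 + 2)) : 'rV[R[i]]_(4 + 2) :=
  pullback (fun u => row i2 (th u)) y
  + fibre_coord y *: pullback (fun u => row i4 (th u)) y.

Definition twistor_B' (R : realType) (th : 'rV[R]_4 -> 'M[R[i]]_4)
    (y : 'rV[R]_(4 + 2)) : 'rV[R[i]]_(4 + 2) :=
  pullback (fun u => row i3 (th u)) y
  + fibre_coord y *: pullback (fun u => row i1 (th u)) y.

Definition closed_on_P (R : realType) (X : oriented_manifold4 R)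
    (G : weyl_geometry X) : Prop :=
  forall c V th Gam, null_cotetrad G c V th ->
    weyl_connection V (fun=> null_gram R) (weyl_form G c) th Gam ->
    closed_ideal3 (patch V) (twistor_E Gam) (twistor_F th) (twistor_B th).

Definition closed_on_P' (R : realType) (X : oriented_manifold4 R)
    (G : weyl_geometry X) : Prop :=
  forall c V th Gam, null_cotetrad G c V th ->
    weyl_connection V (fun=> null_gram R) (weyl_form G c) th Gam ->
    closed_ideal3 (patch V) (twistor_E' Gam) (twistor_F' th) (twistor_B' th).

(* Main.v *)
(* Modulo F and B, changing the 1-form A changes E only by a combination of F
   and B with smooth coefficients, so the Weyl connection may be replaced by the
   Levi-Civita connection.  The torsion-free structure equations put dF and dB
   in the ideal (E, F, B), and dE is congruent to
   - R^3_2 + z (R^1_1 - R^4_4) + z^2 R^2_3, where R is the curvature.  Wedged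
   with E, F and B this is, up to a nonvanishing factor, a quartic in z whose
   coefficients are the five components of the self-dual Weyl tensor: the Ricci
   part drops out because F /\ B is null.  Exchanging theta^1 and theta^2
   reverses the orientation and turns the first statement into the second. *)

(* The definitions quantify over all connections of a given null cotetrad, so Levi-Civita and Weyl
   connections are compared on one fixed coframe: adding an explicit difference tensor turns one
   kind into the other, and the tensor of [-A] undoes this. The quartic is the curvature evaluated,
   in both index pairs, on the bivector (zm - k) /\ (zn - p) of the null plane; hence its degree. It
   may be tested at every z because a patch is the whole of V x C. Isolating it from the 5-form
   requires P /\ K /\ E /\ F /\ B to be nonzero, which holds because E alone among these covectors
   has a dz part. Matching its coefficients with the Weyl tensor uses the pair symmetry of the
   Riemann tensor, hence the first Bianchi identity, hence d(d theta) = 0; since smoothness is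
   phrased with iterated partial derivatives, this rests on the symmetry of second derivatives. The
   equivalence over one coframe asks for invertibility only, so that it also applies after M and P
   are exchanged, when the volume form has the wrong sign for a null cotetrad. *)
Require Import Defs.
From mathcomp Require Import all_boot all_order all_algebra.
From mathcomp Require Import all_classical all_reals all_analysis.
From mathcomp Require Import ring lra.

Set Implicit Arguments.
Unset Strict Implicit.
Unset Printing Implicit Defensive.

Import Order.TTheory GRing.Theory Num.Theory.
Import numFieldNormedType.Exports.

Local Open Scope classical_set_scope.
Local Open Scope complex_scope.
Local Open Scope ring_scope.

(** * Symmetry of second derivatives *)

Section Schwarz.
Variables (R : realType) (V : normedModType R).
Implicit Types (f : V -> R) (u v w p : V).

Lemma is_derive_line f v p (x : R) : derivable f (x *: v + p) v ->
  is_derive x 1 (fun h : R => f (h *: v + p)) ('D_v f (x *: v + p)).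
Proof.
move=> fd; apply: DeriveDef.
  move: fd; rewrite /derivable.
  set g1 := fun h => h^-1 *: _; set g2 := fun h => h^-1 *: _.
  suff -> : g1 = g2 by [].
  by apply/funext => h; rewrite /g1 /g2 /= scalerDl addrA [_%:A]mulr1.
rewrite /derive; set g1 := fun h => h^-1 *: _; set g2 := fun h => h^-1 *: _.
suff -> : g1 = g2 by [].
by apply/funext => h; rewrite /g1 /g2 /= scalerDl addrA [_%:A]mulr1.
Qed.

(** The mean value theorem is used twice: along v for the increment of [f] in the direction w, then
    along w for ['D_v f]. The second difference is symmetric in v and w, so exchanging them yields
    the other mixed derivative. *)
Lemma second_difference_mvt f u v w (t : R) : 0 < t ->
  (forall x y : R, 0 <= x <= t -> 0 <= y <= t ->
     derivable f (x *: v + (y *: w + u)) v /\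
     derivable ('D_v f) (x *: v + (y *: w + u)) w) ->
  exists x y : R, [/\ 0 <= x <= t, 0 <= y <= t &
    f (t *: v + (t *: w + u)) - f (t *: v + u) - f (t *: w + u) + f u
    = t ^+ 2 * 'D_w ('D_v f) (x *: v + (y *: w + u))].
Proof.
move=> t0 fd.
have itvP (x : R) : x \in `[0, t]%R -> 0 <= x <= t by rewrite in_itv.
have itvoP (x : R) : x \in `]0, t[%R -> 0 <= x <= t.
  by rewrite in_itv /= => /andP[/ltW -> /ltW ->].
have t00 : 0 <= (0 : R) <= t by rewrite lexx ltW.
have ttt : 0 <= t <= t by rewrite lexx ltW.
pose phi x := f (x *: v + (t *: w + u)) - f (x *: v + (0 *: w + u)).
pose dphi x := 'D_v f (x *: v + (t *: w + u)) - 'D_v f (x *: v + (0 *: w + u)).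
have phid x : 0 <= x <= t -> is_derive x 1 phi (dphi x).
  move=> xt; apply: is_deriveB; apply: is_derive_line.
    by have [] := fd _ _ xt ttt.
  by have [] := fd _ _ xt t00.
have [||x /itvoP xt Ex] := @MVT R phi dphi 0 t t0.
- by move=> x /itvoP; exact: phid.
- apply: derivable_within_continuous => x /itvP /phid dx.
  exact: ex_derive.
pose psi y := 'D_v f (y *: w + (x *: v + u)).
pose dpsi y := 'D_w ('D_v f) (y *: w + (x *: v + u)).
have psid y : 0 <= y <= t -> is_derive y 1 psi (dpsi y).
  by move=> yt; apply: is_derive_line; rewrite addrCA; have [] := fd _ _ xt yt.
have [||y /itvoP yt Ey] := @MVT R psi dpsi 0 t t0.
- by move=> y /itvoP; exact: psid.
- apply: derivable_within_continuous => y /itvP /psid dy.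
  exact: ex_derive.
exists x, y; split => //.
move: Ex Ey; rewrite /phi /dphi /psi /dpsi !scale0r !add0r !subr0.
rewrite ![_ *: w + (x *: v + u)]addrCA => Ex Ey.
rewrite Ey in Ex.
by rewrite expr2 mulrC mulrA -Ex; ring.
Qed.

Lemma dist_half_le (e r s q : R) :
  `|r - q| < e / 2 -> `|s - q| < e / 2 -> `|r - s| <= e.
Proof.
move=> rq sq; rewrite (le_trans (ler_distD q _ _)) // [e]splitr ltW //.
by rewrite ltrD // distrC.
Qed.

(** Both orders compute the same second difference, at two possibly different points of a small
    parallelogram at u; continuity at u then brings the two mixed derivatives within any e of each
    other. *)
Lemma derive_comm f u v w :
  (\forall p \near u, [/\ derivable f p v, derivable f p w,
     derivable ('D_v f) p w & derivable ('D_w f) p v]) ->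
  {for u, continuous ('D_w ('D_v f))} -> {for u, continuous ('D_v ('D_w f))} ->
  'D_w ('D_v f) u = 'D_v ('D_w f) u.
Proof.
move=> fd cwv cvw; apply/eqP; rewrite -subr_eq0 -normr_le0.
apply/ler_addgt0Pl => e e0; rewrite addr0.
have e20 : 0 < e / 2 by rewrite divr_gt0.
have fnear : \forall p \near u, [/\ derivable f p v, derivable f p w,
     derivable ('D_v f) p w & derivable ('D_w f) p v] /\
     (`|'D_w ('D_v f) u - 'D_w ('D_v f) p| < e / 2 /\
     `|'D_v ('D_w f) u - 'D_v ('D_w f) p| < e / 2).
  apply: filterI => //; apply: filterI.
    by move/cvgrPdist_lt: cwv; apply.
  by move/cvgrPdist_lt: cvw; apply.
have /nbhs_ballP[d /= d0 Hd] := fnear.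
(* With t = d / (2c) the parallelogram spanned by t v and t w stays in the ball of radius d; the
   summand 1 keeps c positive when v = w = 0. *)
pose c := `|v| + `|w| + 1.
have c0 : 0 < c by rewrite ltr_wpDl // addr_ge0.
pose t := d / 2 / c.
have t0 : 0 < t by rewrite !divr_gt0.
have inball x y : 0 <= x <= t -> 0 <= y <= t ->
    ball u d (x *: v + (y *: w + u)).
  move=> /andP[x0 xt] /andP[y0 yt]; rewrite -ball_normE /= addrA opprD addrCA.
  rewrite subrr addr0 normrN (le_lt_trans (ler_normD _ _)) // !normrZ.
  rewrite !ger0_norm //.
  apply: (@le_lt_trans _ _ (t * c)).
    rewrite /c !mulrDr mulr1.
    have := ler_wpM2r (normr_ge0 v) xt; have := ler_wpM2r (normr_ge0 w) yt.
    by have := ltW t0; lra.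
  by rewrite /t divfK ?gt_eqF //; lra.
have [||x [y [xt yt E1]]] := @second_difference_mvt f u v w t.
- by [].
- move=> x y xt yt; have [[fv _ fvw _] _] := Hd _ (inball _ _ xt yt).
  exact: (conj fv fvw).
have [||x' [y' [xt' yt' E2]]] := @second_difference_mvt f u w v t.
- by [].
- move=> x1 y1 xt1 yt1; rewrite addrCA.
  have [[_ fw _ fwv] _] := Hd _ (inball _ _ yt1 xt1).
  exact: (conj fw fwv).
have e1 : t *: w + (t *: v + u) = t *: v + (t *: w + u) by rewrite addrCA.
have e2 : x' *: w + (y' *: v + u) = y' *: v + (x' *: w + u) by rewrite addrCA.
rewrite e1 e2 in E2.
have E : 'D_w ('D_v f) (x *: v + (y *: w + u)) =
         'D_v ('D_w f) (y' *: v + (x' *: w + u)).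
  have tn0 : t ^+ 2 != 0 by rewrite expf_neq0 // gt_eqF.
  apply: (mulfI tn0); apply: (etrans (esym E1)); apply: etrans E2.
  by congr (_ + _); exact: addrAC.
have [_ [H1 _]] := Hd _ (inball _ _ xt yt).
have [_ [_ H2]] := Hd _ (inball _ _ yt' xt').
rewrite E in H1.
exact: dist_half_le H1 H2.
Qed.

End Schwarz.

(** * Smooth functions *)

Lemma Ck_sub (R : realType) n (V V' : set 'rV[R]_n) k f :
  V' `<=` V -> Ck k V f -> Ck k V' f.
Proof.
move=> VV'; elim: k f => [|k IH] f [cf df]; first by split=> // u /VV'; exact: cf.
split=> [u /VV'|a]; first exact: cf.
by have [da Da] := df a; split=> [u /VV'|]; [exact: da|exact: IH].
Qed.

Section CkCalculus.
Variables (R : realType) (n : nat) (V : set 'rV[R]_n).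
Hypothesis openV : open V.
Implicit Types (f g : 'rV[R]_n -> R) (k : nat).

Lemma near_open f g u : (forall v, V v -> f v = g v) -> V u ->
  \forall v \near u, f v = g v.
Proof.
move=> fg Vu; have : nbhs u V by apply: open_nbhs_nbhs.
by apply: filterS => v; exact: fg.
Qed.

Lemma continuous_open_ext f g u : (forall v, V v -> f v = g v) -> V u ->
  {for u, continuous f} -> {for u, continuous g}.
Proof.
move=> fg Vu cf; rewrite /prop_for /continuous_at -(fg _ Vu).
apply: cvg_trans cf; apply: near_eq_cvg; first exact: (nbhs_filter u).
exact: near_open.
Qed.

(** Derivatives at a point of an open set depend only on the values in that set; this lets
    identities known on V alone be differentiated. *)
Lemma Ck_ext k f g : (forall v, V v -> f v = g v) -> Ck k V f -> Ck k V g.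
Proof.
elim: k f g => [|k IH] f g fg [cf df].
  by split => // u Vu; apply: continuous_open_ext fg Vu (cf u Vu).
split; first by move=> u Vu; apply: continuous_open_ext fg Vu (cf u Vu).
move=> a; have [da Da] := df a; split=> [u Vu|].
  by apply: near_eq_derivable (da u Vu); apply: near_open.
apply: IH Da => u Vu; apply: near_eq_derive.
exact: near_open.
Qed.

Lemma Ck_cst k (c : R) : Ck k V (fun=> c).
Proof.
elim: k c => [|k IH] c.
  by split => // u _; exact: cst_continuous.
split; first by move=> u _; exact: cst_continuous.
move=> a; split=> [u _|]; first exact: derivable_cst.
by apply: Ck_ext (IH 0) => u _; rewrite derive_cst.
Qed.

Lemma CkW k f : Ck k.+1 V f -> Ck k V f.
Proof.
elim: k f => [|k IH] f [cf df]; split => // a.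
by have [da Da] := df a; split => //; exact: IH.
Qed.

Lemma CkD k f g : Ck k V f -> Ck k V g -> Ck k V (fun u => f u + g u).
Proof.
elim: k f g => [|k IH] f g [cf df] [cg dg]; split => //.
- by move=> u Vu; exact: continuousD (cf u Vu) (cg u Vu).
- by move=> u Vu; exact: continuousD (cf u Vu) (cg u Vu).
move=> a; have [da Da] := df a; have [ea Ea] := dg a.
split=> [u Vu|]; first by apply: derivableD; [exact: da|exact: ea].
apply: Ck_ext (IH _ _ Da Ea) => u Vu.
by rewrite -deriveD; [|exact: da|exact: ea].
Qed.

Lemma CkM k f g : Ck k V f -> Ck k V g -> Ck k V (fun u => f u * g u).
Proof.
elim: k f g => [|k IH] f g Cf Cg; have [cf df] := Cf; have [cg dg] := Cg; split => //.
- by move=> u Vu; exact: continuousM (cf u Vu) (cg u Vu).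
- by move=> u Vu; exact: continuousM (cf u Vu) (cg u Vu).
move=> a; have [da Da] := df a; have [ea Ea] := dg a.
split=> [u Vu|]; first by apply: derivableM; [exact: da|exact: ea].
apply: Ck_ext (CkD (IH _ _ (CkW Cf) Ea) (IH _ _ (CkW Cg) Da)) => u Vu.
by rewrite -[RHS]/('D_(delta_mx 0 a) (f * g) u) deriveM //; [exact: da|exact: ea].
Qed.

Lemma CkV k f : (forall u, V u -> f u != 0) -> Ck k V f ->
  Ck k V (fun u => (f u)^-1).
Proof.
move=> f0; elim: k => [|k IH] Cf; have [cf df] := Cf; split => //.
- by move=> u Vu; exact: continuousV (f0 u Vu) (cf u Vu).
- by move=> u Vu; exact: continuousV (f0 u Vu) (cf u Vu).
move=> a; have [da Da] := df a.
split=> [u Vu|]; first by apply: derivableV; [exact: f0|exact: da].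
(* The derivative of 1/f is -(1/f)^2 f', so order k+1 needs only order k of 1/f itself; the
   induction therefore keeps f fixed. *)
have Cif := IH (CkW Cf).
apply: Ck_ext (CkM (CkM (Ck_cst k (-1)) (CkM Cif Cif)) Da) => u Vu.
rewrite deriveV; [|exact: f0|exact: da].
by rewrite mulN1r -expr2 exprVn.
Qed.

Lemma smooth_ext f g : (forall v, V v -> f v = g v) -> smooth V f -> smooth V g.
Proof. by move=> fg sf k; apply: Ck_ext fg (sf k). Qed.

Lemma smooth_cst (c : R) : smooth V (fun=> c).
Proof. by move=> k; exact: Ck_cst. Qed.

Lemma smoothD f g : smooth V f -> smooth V g -> smooth V (fun u => f u + g u).
Proof. by move=> sf sg k; apply: CkD. Qed.

Lemma smoothM f g : smooth V f -> smooth V g -> smooth V (fun u => f u * g u).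
Proof. by move=> sf sg k; apply: CkM. Qed.

Lemma smoothN f : smooth V f -> smooth V (fun u => - f u).
Proof.
move=> sf; apply: smooth_ext (smoothM (smooth_cst (-1)) sf) => u _.
by rewrite mulN1r.
Qed.

Lemma smoothV f : (forall u, V u -> f u != 0) -> smooth V f ->
  smooth V (fun u => (f u)^-1).
Proof. by move=> f0 sf k; apply: CkV. Qed.

Lemma smooth_derivable f a u : V u -> smooth V f ->
  derivable f u (delta_mx 0 a).
Proof. by move=> Vu /(_ 1)[_ /(_ a)[+ _]]; apply. Qed.

Lemma smooth_derive f a : smooth V f -> smooth V ('D_(delta_mx 0 a) f).
Proof. by move=> sf k; have [_ /(_ a)[]] := sf k.+1. Qed.

Lemma smooth_derive_comm f a b u : V u -> smooth V f ->
  'D_(delta_mx 0 a) ('D_(delta_mx 0 b) f) u =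
  'D_(delta_mx 0 b) ('D_(delta_mx 0 a) f) u.
Proof.
move=> Vu sf; apply: derive_comm.
- have : nbhs u V by apply: open_nbhs_nbhs.
  apply: filterS => p Vp.
  have sa := smooth_derive a sf; have sb := smooth_derive b sf.
  by split; [exact: smooth_derivable Vp sf|exact: smooth_derivable Vp sf
    |exact: smooth_derivable Vp sb|exact: smooth_derivable Vp sa].
- by have [+ _] := smooth_derive a (smooth_derive b sf) 0; apply.
- by have [+ _] := smooth_derive b (smooth_derive a sf) 0; apply.
Qed.

End CkCalculus.

(** * Complex-valued smooth functions and their partial derivatives *)

Section ComplexCalculus.
Variables (R : realType) (n : nat) (V : set 'rV[R]_n).
Hypothesis openV : open V.
Implicit Types (f g : 'rV[R]_n -> R[i]).

Lemma csmooth_ext f g : (forall v, V v -> f v = g v) -> csmooth V f -> csmooth V g.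
Proof.
move=> fg [sr si]; split.
  by apply: smooth_ext sr => // u /fg ->.
by apply: smooth_ext si => // u /fg ->.
Qed.

Lemma csmooth_cst (c : R[i]) : csmooth V (fun=> c).
Proof. by split; apply: smooth_cst. Qed.

Lemma csmoothD f g : csmooth V f -> csmooth V g -> csmooth V (fun u => f u + g u).
Proof.
move=> [fr fi] [gr gi]; split.
  by apply: smooth_ext (smoothD _ fr gr) => // u _; rewrite raddfD.
by apply: smooth_ext (smoothD _ fi gi) => // u _; rewrite raddfD.
Qed.

Lemma ReM (x y : R[i]) : complex.Re (x * y) =
  complex.Re x * complex.Re y - complex.Im x * complex.Im y.
Proof. by case: x y => [a b] [c d]. Qed.

Lemma ImM (x y : R[i]) : complex.Im (x * y) =
  complex.Re x * complex.Im y + complex.Im x * complex.Re y.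
Proof. by case: x y => [a b] [c d]. Qed.

Lemma csmoothM f g : csmooth V f -> csmooth V g -> csmooth V (fun u => f u * g u).
Proof.
move=> [fr fi] [gr gi]; split.
  apply: smooth_ext (smoothD _ (smoothM _ fr gr) (smoothN _ (smoothM _ fi gi))) => // u _.
  by rewrite ReM.
apply: smooth_ext (smoothD _ (smoothM _ fr gi) (smoothM _ fi gr)) => // u _.
by rewrite ImM.
Qed.

Lemma csmoothN f : csmooth V f -> csmooth V (fun u => - f u).
Proof.
move=> sf; apply: csmooth_ext (csmoothM (csmooth_cst (-1)) sf) => u _.
by rewrite mulN1r.
Qed.

Lemma csmoothB f g : csmooth V f -> csmooth V g -> csmooth V (fun u => f u - g u).
Proof. by move=> sf sg; apply: csmoothD => //; exact: csmoothN. Qed.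

Lemma csmoothV f : (forall u, V u -> f u != 0) -> csmooth V f ->
  csmooth V (fun u => (f u)^-1).
Proof.
move=> f0 [fr fi].
(* The squared modulus: 1/f is the conjugate of f over q, which reduces the claim to the inverse of
   a real function. *)
pose q u := complex.Re (f u) * complex.Re (f u) + complex.Im (f u) * complex.Im (f u).
have q0 u : V u -> q u != 0.
  move=> /f0; rewrite /q; case: (f u) => a b /= ab0.
  rewrite -!expr2 paddr_eq0 ?sqr_ge0 // !sqrf_eq0.
  by apply: contra ab0 => /andP[/eqP -> /eqP ->].
have sq := smoothV openV q0 (smoothD openV (smoothM openV fr fr) (smoothM openV fi fi)).
split.
  apply: smooth_ext (smoothM openV fr sq) => // u Vu.
  by rewrite /q; case: (f u) => a b /=; rewrite -!expr2.
apply: smooth_ext (smoothN openV (smoothM openV fi sq)) => // u Vu.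
by rewrite /q; case: (f u) => a b /=; rewrite -!expr2.
Qed.

Lemma csmooth_sum (I : Type) (r : seq I) (P : pred I) (F : I -> 'rV[R]_n -> R[i]) :
  (forall i, P i -> csmooth V (F i)) -> csmooth V (fun u => \sum_(i <- r | P i) F i u).
Proof.
move=> sF; elim: r => [|i r IH].
  by apply: csmooth_ext (csmooth_cst 0) => u _; rewrite big_nil.
have [Pi|nPi] := boolP (P i).
  by apply: csmooth_ext (csmoothD (sF i Pi) IH) => u _; rewrite big_cons Pi.
by apply: csmooth_ext IH => u _; rewrite big_cons (negbTE nPi).
Qed.

Lemma csmooth_prod (I : Type) (r : seq I) (P : pred I) (F : I -> 'rV[R]_n -> R[i]) :
  (forall i, P i -> csmooth V (F i)) -> csmooth V (fun u => \prod_(i <- r | P i) F i u).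
Proof.
move=> sF; elim: r => [|i r IH].
  by apply: csmooth_ext (csmooth_cst 1) => u _; rewrite big_nil.
have [Pi|nPi] := boolP (P i).
  by apply: csmooth_ext (csmoothM (sF i Pi) IH) => u _; rewrite big_cons Pi.
by apply: csmooth_ext IH => u _; rewrite big_cons (negbTE nPi).
Qed.

Lemma csmooth_det m (T : 'rV[R]_n -> 'M[R[i]]_m) :
  csmooth_mx V T -> csmooth V (fun u => \det (T u)).
Proof.
move=> sT; apply: csmooth_sum => s _; apply: csmoothM; first exact: csmooth_cst.
by apply: csmooth_prod => i _; exact: sT.
Qed.

(** Cramer's rule: the entries are cofactors over the determinant. *)
Lemma csmooth_invmx m (T : 'rV[R]_n -> 'M[R[i]]_m) :
  (forall u, V u -> T u \in unitmx) ->
  csmooth_mx V T -> csmooth_mx V (fun u => invmx (T u)).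
Proof.
move=> uT sT i j.
have sdV : csmooth V (fun u => (\det (T u))^-1).
  apply: csmoothV; last exact: csmooth_det.
  by move=> u /uT; rewrite unitmxE unitfE.
have sc : csmooth V (fun u => cofactor (T u) j i).
  apply: csmoothM; first exact: csmooth_cst.
  apply: csmooth_det => k l; apply: csmooth_ext (sT (lift j k) (lift i l)) => u _.
  by rewrite !mxE.
apply: csmooth_ext (csmoothM sdV sc) => u Vu.
by rewrite /invmx uT // !mxE.
Qed.

Definition cderivable (f : 'rV[R]_n -> R[i]) u a :=
  derivable (fun v => complex.Re (f v)) u (delta_mx 0 a) /\
  derivable (fun v => complex.Im (f v)) u (delta_mx 0 a).

Lemma csmooth_cderivable f u a : V u -> csmooth V f -> cderivable f u a.
Proof. by move=> Vu [fr fi]; split; apply: smooth_derivable Vu _. Qed.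

Lemma csmooth_cpartial f a : csmooth V f -> csmooth V (cpartial a f).
Proof. by move=> [fr fi]; split; apply: smooth_derive. Qed.

Lemma cpartial_comm f a b u : V u -> csmooth V f ->
  cpartial a (cpartial b f) u = cpartial b (cpartial a f) u.
Proof.
move=> Vu [fr fi]; have er := smooth_derive_comm openV a b Vu fr.
have ei := smooth_derive_comm openV a b Vu fi.
exact: (f_equal2 (@Complex R) er ei).
Qed.

Lemma eq_cpartial f g a u : V u -> (forall v, V v -> f v = g v) ->
  cpartial a f u = cpartial a g u.
Proof.
move=> Vu fg; apply: (f_equal2 (@Complex R)); apply: near_eq_derive.
  by apply: (near_open openV) => // v /fg ->.
by apply: (near_open openV) => // v /fg ->.
Qed.

End ComplexCalculus.

Section CPartial.
Variables (R : realType) (n : nat) (u : 'rV[R]_n) (a : 'I_n).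
Implicit Types (f g : 'rV[R]_n -> R[i]).

Lemma cpartial_cst (c : R[i]) : cpartial a (fun=> c) u = 0.
Proof. by rewrite /cpartial !derive_cst. Qed.

Lemma cderivable_cst (c : R[i]) : cderivable (fun=> c) u a.
Proof. by split; apply: derivable_cst. Qed.

Let ReD f g : (fun v => complex.Re (f v + g v)) =
  (fun v => complex.Re (f v)) + (fun v => complex.Re (g v)).
Proof. by apply/funext => v; rewrite raddfD. Qed.

Let ImD f g : (fun v => complex.Im (f v + g v)) =
  (fun v => complex.Im (f v)) + (fun v => complex.Im (g v)).
Proof. by apply/funext => v; rewrite raddfD. Qed.

Let ReMf f g : (fun v => complex.Re (f v * g v)) =
  (fun v => complex.Re (f v)) * (fun v => complex.Re (g v)) -
  (fun v => complex.Im (f v)) * (fun v => complex.Im (g v)).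
Proof. by apply/funext => v; rewrite ReM. Qed.

Let ImMf f g : (fun v => complex.Im (f v * g v)) =
  (fun v => complex.Re (f v)) * (fun v => complex.Im (g v)) +
  (fun v => complex.Im (f v)) * (fun v => complex.Re (g v)).
Proof. by apply/funext => v; rewrite ImM. Qed.

Lemma cderivableD f g : cderivable f u a -> cderivable g u a ->
  cderivable (fun v => f v + g v) u a.
Proof.
move=> [fr fi] [gr gi]; rewrite /cderivable ReD ImD.
exact: (conj (derivableD fr gr) (derivableD fi gi)).
Qed.

Lemma cpartialD f g : cderivable f u a -> cderivable g u a ->
  cpartial a (fun v => f v + g v) u = cpartial a f u + cpartial a g u.
Proof.
move=> [fr fi] [gr gi]; rewrite /cpartial ReD ImD.
by rewrite (deriveD fr gr) (deriveD fi gi).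
Qed.

Lemma cderivableM f g : cderivable f u a -> cderivable g u a ->
  cderivable (fun v => f v * g v) u a.
Proof.
move=> [fr fi] [gr gi]; rewrite /cderivable ReMf ImMf.
split; first exact: derivableB (derivableM fr gr) (derivableM fi gi).
exact: derivableD (derivableM fr gi) (derivableM fi gr).
Qed.

Lemma cpartialM f g : cderivable f u a -> cderivable g u a ->
  cpartial a (fun v => f v * g v) u = cpartial a f u * g u + f u * cpartial a g u.
Proof.
move=> [fr fi] [gr gi]; rewrite /cpartial ReMf ImMf.
rewrite (deriveB (derivableM fr gr) (derivableM fi gi)).
rewrite (deriveD (derivableM fr gi) (derivableM fi gr)).
rewrite (deriveM fr gr) (deriveM fi gi) (deriveM fr gi) (deriveM fi gr).
move: ('D_(delta_mx 0 a) (fun v => complex.Re (f v)) u) => fr'.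
move: ('D_(delta_mx 0 a) (fun v => complex.Im (f v)) u) => fi'.
move: ('D_(delta_mx 0 a) (fun v => complex.Re (g v)) u) => gr'.
move: ('D_(delta_mx 0 a) (fun v => complex.Im (g v)) u) => gi'.
case: (f u) (g u) => [x y] [z t] {fr fi gr gi} /=.
apply/eqP; rewrite eq_complex /= /GRing.scale /=.
by apply/andP; split; apply/eqP; ring.
Qed.

Lemma cpartialZ x f : cderivable f u a ->
  cpartial a (fun v => x * f v) u = x * cpartial a f u.
Proof.
move=> df; rewrite (cpartialM (cderivable_cst x) df).
by rewrite cpartial_cst mul0r add0r.
Qed.

Lemma cderivableN f : cderivable f u a -> cderivable (fun v => - f v) u a.
Proof.
move=> df; have -> : (fun v => - f v) = (fun v => (-1) * f v).
  by apply/funext => v; rewrite mulN1r.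
by apply: cderivableM => //; exact: cderivable_cst.
Qed.

Lemma cpartialN f : cderivable f u a ->
  cpartial a (fun v => - f v) u = - cpartial a f u.
Proof.
move=> df; have -> : (fun v => - f v) = (fun v => (-1) * f v).
  by apply/funext => v; rewrite mulN1r.
rewrite (cpartialM (cderivable_cst (-1)) df).
by rewrite cpartial_cst mul0r add0r mulN1r.
Qed.

Lemma cderivable_sum (I : Type) (r : seq I) (F : I -> 'rV[R]_n -> R[i]) :
  (forall i, cderivable (F i) u a) -> cderivable (fun v => \sum_(i <- r) F i v) u a.
Proof.
move=> dF; elim: r => [|i r IH].
  rewrite (_ : (fun v => _) = fun=> 0); first exact: cderivable_cst.
  by apply/funext => v; rewrite big_nil.
rewrite (_ : (fun v => _) = fun v => F i v + \sum_(j <- r) F j v).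
  exact: cderivableD.
by apply/funext => v; rewrite big_cons.
Qed.

Lemma cpartial_sum (I : Type) (r : seq I) (F : I -> 'rV[R]_n -> R[i]) :
  (forall i, cderivable (F i) u a) ->
  cpartial a (fun v => \sum_(i <- r) F i v) u = \sum_(i <- r) cpartial a (F i) u.
Proof.
move=> dF; elim: r => [|i r IH].
  rewrite big_nil (_ : (fun v => _) = fun=> 0); first exact: cpartial_cst.
  by apply/funext => v; rewrite big_nil.
rewrite big_cons -IH -cpartialD //; last exact: cderivable_sum.
by congr cpartial; apply/funext => v; rewrite big_cons.
Qed.

End CPartial.

(** * Exterior algebra *)

Section Exterior.
Variables (R : realType) (n : nat).
Implicit Types (a b c : 'rV[R[i]]_n).

(** Has the same form as the index function inside [riemann_up], so that curvature components are
    frame components by computation. *)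
Definition pairi (a b : 'I_n) : 'I_2 -> 'I_n := fun t => if t == 0 then a else b.

Lemma pairi_eta (I : 'I_2 -> 'I_n) : pairi (I 0) (I 1) = I.
Proof.
apply/funext => t; rewrite /pairi; case: eqP => [->//|].
case: t => [[|[|//]]] lt0 t0; last by congr I; apply: val_inj.
by case: t0; apply: val_inj.
Qed.

Lemma wedge11E a b (I : 'I_2 -> 'I_n) :
  wedge11 a b I = a 0 (I 0) * b 0 (I 1) - a 0 (I 1) * b 0 (I 0).
Proof.
rewrite /wedge11 /wedge /of_covector !big_ord_recl big_ord0 addr0 /=.
rewrite expr1 expr0 mulN1r mul1r addrC mulNr.
by congr (a 0 (I _) * b 0 (I _) - a 0 (I _) * b 0 (I _)); apply: val_inj.
Qed.

Lemma wedgeDl k (w w' : kform R n k) b :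
  wedge (fun J => w J + w' J) b = fun I => wedge w b I + wedge w' b I.
Proof.
apply/funext => I; rewrite /wedge -big_split /=; apply: eq_bigr => i _.
by rewrite mulrDr mulrDl.
Qed.

Lemma wedgeZl k x (w : kform R n k) b :
  wedge (fun J => x * w J) b = fun I => x * wedge w b I.
Proof.
apply/funext => I; rewrite /wedge mulr_sumr; apply: eq_bigr => i _.
by rewrite mulrCA !mulrA.
Qed.

Lemma wedge0l k b : wedge (fun=> 0 : R[i]) b = (fun=> 0) :> kform R n k.+1.
Proof.
by apply/funext => I; rewrite /wedge big1 // => i _; rewrite mulr0 mul0r.
Qed.

Lemma wedgeDr k (w : kform R n k) b c I :
  wedge w (b + c) I = wedge w b I + wedge w c I.
Proof.
rewrite /wedge -big_split /=; apply: eq_bigr => i _.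
by rewrite mxE mulrDr.
Qed.

Lemma wedgeZr k (w : kform R n k) x b I : wedge w (x *: b) I = x * wedge w b I.
Proof.
rewrite /wedge mulr_sumr; apply: eq_bigr => i _.
by rewrite mxE mulrCA.
Qed.

(* Laplace expansion along the last row. *)
Lemma wedge_det k (s : seq 'rV[R[i]]_n) b : size s = k ->
  wedge (fun J : 'I_k -> 'I_n => \det (\matrix_(r, c) (s`_r) 0 (J c))) b =
  fun I => \det (\matrix_(r < k.+1, c < k.+1) ((rcons s b)`_r) 0 (I c)).
Proof.
move=> sk; apply/funext => I; rewrite (expand_det_row _ ord_max) /wedge.
apply: eq_bigr => i _; rewrite mxE nth_rcons sk ltnn eqxx mulrC; congr (_ * _).
rewrite /cofactor; congr (_ * _).
  by rewrite -[LHS]signr_odd -[RHS]signr_odd oddB ?leq_ord // oddD.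
congr (\det _); apply/matrixP => r c; rewrite !mxE lift_max nth_rcons sk.
by rewrite ltn_ord.
Qed.

Variables (E F B : 'rV[R[i]]_n) (I : 'I_5 -> 'I_n).

(** With the indices [I] fixed, the 5-form of the ideal condition becomes a scalar linear functional
    of the 2-form; all later algebra takes place on such scalars. *)
Definition wedge3 (w : kform R n 2) : R[i] := wedge (wedge (wedge w E) F) B I.

Definition wedge5 a b : R[i] := wedge3 (wedge11 a b).

(** As a determinant the 5-form visibly vanishes when a covector is repeated, which is the only fact
    about E, F and B needed to compute modulo them. *)
Lemma wedge5_det a b :
  wedge5 a b = \det (\matrix_(r < 5, c < 5) ([:: a; b; E; F; B]`_r) 0 (I c)).
Proof.
rewrite /wedge5 /wedge3 /wedge11.
have -> : of_covector a = fun J => \det (\matrix_(r, c) ([:: a]`_r) 0 (J c)).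
  by apply/funext => J; rewrite [\matrix_(_, _) _]mx11_scalar det_scalar1 mxE.
by do !rewrite wedge_det //.
Qed.

Lemma wedge3D w w' : wedge3 (fun J => w J + w' J) = wedge3 w + wedge3 w'.
Proof. by rewrite /wedge3 !wedgeDl. Qed.

Lemma wedge3Z x w : wedge3 (fun J => x * w J) = x * wedge3 w.
Proof. by rewrite /wedge3 !wedgeZl. Qed.

Lemma wedge3N w : wedge3 (fun J => - w J) = - wedge3 w.
Proof.
rewrite -mulN1r -wedge3Z; congr wedge3; apply/funext => J.
by rewrite mulN1r.
Qed.

Lemma wedge3_0 : wedge3 (fun=> 0) = 0.
Proof. by rewrite /wedge3 !wedge0l. Qed.

Lemma wedge3_sum (T : Type) (r : seq T) (w : T -> kform R n 2) :
  wedge3 (fun J => \sum_(t <- r) w t J) = \sum_(t <- r) wedge3 (w t).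
Proof.
elim: r => [|t r IH].
  rewrite big_nil -[RHS]wedge3_0; congr wedge3; apply/funext => J.
  by rewrite big_nil.
rewrite big_cons -IH -wedge3D; congr wedge3; apply/funext => J.
by rewrite big_cons.
Qed.

Lemma wedge3_sum11 (J : finType) (a b : J -> 'rV[R[i]]_n) :
  wedge3 (fun K => \sum_j wedge11 (a j) (b j) K) = \sum_j wedge5 (a j) (b j).
Proof. exact: wedge3_sum. Qed.

Lemma wedge5_anti a b : wedge5 b a = - wedge5 a b.
Proof.
rewrite /wedge5 -wedge3N; congr wedge3; apply/funext => J.
by rewrite !wedge11E; ring.
Qed.

Lemma wedge5Dr a b c : wedge5 a (b + c) = wedge5 a b + wedge5 a c.
Proof.
rewrite /wedge5 -wedge3D; congr wedge3; apply/funext => J.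
by rewrite !wedge11E !mxE; ring.
Qed.

Lemma wedge5Zr x a b : wedge5 a (x *: b) = x * wedge5 a b.
Proof.
rewrite /wedge5 -wedge3Z; congr wedge3; apply/funext => J.
by rewrite !wedge11E !mxE; ring.
Qed.

Lemma wedge5Nr a b : wedge5 a (- b) = - wedge5 a b.
Proof. by rewrite -scaleN1r wedge5Zr mulN1r. Qed.

Lemma wedge5Dl a b c : wedge5 (a + b) c = wedge5 a c + wedge5 b c.
Proof. by rewrite wedge5_anti wedge5Dr opprD -!wedge5_anti. Qed.

Lemma wedge5Zl x a b : wedge5 (x *: a) b = x * wedge5 a b.
Proof. by rewrite wedge5_anti wedge5Zr -mulrN -wedge5_anti. Qed.

Lemma wedge5Nl a b : wedge5 (- a) b = - wedge5 a b.
Proof. by rewrite wedge5_anti wedge5Nr -wedge5_anti. Qed.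

Lemma wedge5_dup a b (r1 r2 : 'I_5) : r1 != r2 ->
  [:: a; b; E; F; B]`_r1 = [:: a; b; E; F; B]`_r2 -> wedge5 a b = 0.
Proof.
move=> r12 e; rewrite wedge5_det; apply: (determinant_alternate r12) => c.
by rewrite !mxE e.
Qed.

Lemma wedge5_diag a : wedge5 a a = 0.
Proof. by apply: (@wedge5_dup a a ord0 (lift ord0 ord0)). Qed.

Lemma wedge5_E a : wedge5 a E = 0.
Proof.
by apply: (@wedge5_dup a E (inord 1) (inord 2)); rewrite -?val_eqE /= !inordK.
Qed.

Lemma wedge5_F a : wedge5 a F = 0.
Proof.
by apply: (@wedge5_dup a F (inord 1) (inord 3)); rewrite -?val_eqE /= !inordK.
Qed.

Lemma wedge5_B a : wedge5 a B = 0.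
Proof.
by apply: (@wedge5_dup a B (inord 1) (inord 4)); rewrite -?val_eqE /= !inordK.
Qed.

End Exterior.

(** * Algebraic Weyl tensors *)

Section WeylAlgebra.
Variables (C : numFieldType) (L : 'I_4 -> 'I_4 -> 'I_4 -> 'I_4 -> C).
Hypothesis Lanti1 : forall i j k l, L j i k l = - L i j k l.
Hypothesis Lanti2 : forall i j k l, L i j l k = - L i j k l.
Hypothesis Lbianchi : forall i j k l, L i j k l + L i k l j + L i l j k = 0.

(** The entries of [null_gram], given by cases so that they simplify to numbers on concrete
    indices. *)
Definition gram4 (i j : 'I_4) : C :=
  match val i, val j with
  | 0, 1 | 1, 0 => 2^-1
  | 2, 3 | 3, 2 => - 2^-1
  | _, _ => 0
  end.

(** The contraction with the inverse metric, whose nonzero entries are g^12 = g^21 = 2 and g^34 =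
    g^43 = -2. *)
Definition low_ricci (j l : 'I_4) : C :=
  2 * L i2 j i1 l + 2 * L i1 j i2 l - 2 * L i4 j i3 l - 2 * L i3 j i4 l.

Definition low_scalar : C :=
  2 * low_ricci i1 i2 + 2 * low_ricci i2 i1
  - 2 * low_ricci i3 i4 - 2 * low_ricci i4 i3.

Definition low_weyl (i j k l : 'I_4) : C :=
  L i j k l
  - 2^-1 * (gram4 i k * low_ricci j l - gram4 i l * low_ricci j k
            - gram4 j k * low_ricci i l + gram4 j l * low_ricci i k)
  + low_scalar / 6 * (gram4 i k * gram4 j l - gram4 i l * gram4 j k).

Let n2 : (2 : C) != 0. Proof. by rewrite pnatr_eq0. Qed.

(** The classical octahedron argument: in the combination B1 - B2 - B3 + B4 of the cyclic identities
    at the four rotations of (i, j, k, l), everything cancels except twice the difference of the two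
    sides. *)
Lemma pair_symmetry i j k l : L i j k l = L k l i j.
Proof.
have B1 := Lbianchi i j k l; have B2 := Lbianchi j k l i.
have B3 := Lbianchi k l i j; have B4 := Lbianchi l i j k.
have [e1 e2 e3] : [/\ L i k l j = - L i k j l, L j k l i = - L j k i l
  & L j i k l = - L i j k l] by split; [exact: Lanti2|exact: Lanti2|exact: Lanti1].
have [e4 e5 e6] : [/\ L k i j l = - L i k j l, L k j l i = L j k i l
  & L l i j k = - L i l j k].
  by split; [exact: Lanti1|rewrite Lanti1 Lanti2 opprK|exact: Lanti1].
have [e7 e8] : L l j k i = L j l i k /\ L l k i j = - L k l i j.
  by split; [rewrite Lanti1 Lanti2 opprK|exact: Lanti1].
apply: (mulfI n2); move: B1 B2 B3 B4; rewrite {}e1 {}e2 {}e3 {}e4 {}e5 {}e6 {}e7 {}e8.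
move: (L i j k l) (L k l i j) (L i k j l) (L j l i k) (L i l j k) (L j k i l).
move=> a a' b b' c c' B1 B2 B3 B4; apply/eqP; rewrite -subr_eq0; apply/eqP.
have -> : 2 * a - 2 * a' = (a - b + c) - (a' - b + c') - (- c' + b' - a)
  + (- c + b' - a') by ring.
by rewrite B1 B2 B3 B4 !subr0 addr0.
Qed.

Lemma Lii i k l : L i i k l = 0.
Proof.
apply: (mulfI n2); rewrite mulr0 mulr_natl mulr2n.
by rewrite {1}Lanti1 addNr.
Qed.

Lemma Lkk i j k : L i j k k = 0.
Proof. by rewrite pair_symmetry Lii. Qed.

(** These rules order the indices within each pair, [Lpair] orders the two pairs, and [bianchi1423]
    removes one component more: 20 independent components of a curvature tensor remain, and
    identities between them become polynomial. *)
Let Lsimp := (Lii, Lkk, 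
   (Lanti1 i1 i2),
   (Lanti1 i1 i3),
   (Lanti1 i1 i4),
   (Lanti1 i2 i3),
   (Lanti1 i2 i4),
   (Lanti1 i3 i4),
   (fun i j => Lanti2 i j i1 i2),
   (fun i j => Lanti2 i j i1 i3),
   (fun i j => Lanti2 i j i1 i4),
   (fun i j => Lanti2 i j i2 i3),
   (fun i j => Lanti2 i j i2 i4),
   (fun i j => Lanti2 i j i3 i4)).

Let Lpair := (
   pair_symmetry i1 i3 i1 i2,
   pair_symmetry i1 i4 i1 i2,
   pair_symmetry i2 i3 i1 i2,
   pair_symmetry i2 i4 i1 i2,
   pair_symmetry i3 i4 i1 i2,
   pair_symmetry i1 i4 i1 i3,
   pair_symmetry i2 i3 i1 i3,
   pair_symmetry i2 i4 i1 i3,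
   pair_symmetry i3 i4 i1 i3,
   pair_symmetry i2 i3 i1 i4,
   pair_symmetry i2 i4 i1 i4,
   pair_symmetry i3 i4 i1 i4,
   pair_symmetry i2 i4 i2 i3,
   pair_symmetry i3 i4 i2 i3,
   pair_symmetry i3 i4 i2 i4).

Lemma bianchi1423 : L i1 i4 i2 i3 = L i1 i3 i2 i4 - L i1 i2 i3 i4.
Proof.
apply/eqP; rewrite -subr_eq0; apply/eqP; rewrite -[RHS](Lbianchi i1 i2 i3 i4).
by rewrite !Lsimp; ring.
Qed.

(* The five components of the self-dual part of the Weyl tensor. *)
Definition psi0 : C := L i2 i4 i2 i4.
Definition psi1 : C := L i2 i4 i1 i2 - L i2 i4 i3 i4 + (L i1 i2 i2 i4 - L i3 i4 i2 i4).
Definition psi2 : C := L i1 i2 i1 i2 - L i1 i2 i3 i4 - L i3 i4 i1 i2 + L i3 i4 i3 i4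
  - L i2 i4 i1 i3 - L i1 i3 i2 i4.
Definition psi3 : C := L i1 i3 i1 i2 - L i1 i3 i3 i4 + (L i1 i2 i1 i3 - L i3 i4 i1 i3).
Definition psi4 : C := L i1 i3 i1 i3.

(** No component along P /\ K, N /\ M or N /\ K - M /\ P. The third condition is an equality because
    N /\ K + M /\ P has equal components 12 and 34. *)
Definition asd_components (i j : 'I_4) : Prop :=
  [/\ low_weyl i j i2 i4 = 0, low_weyl i j i1 i3 = 0
    & low_weyl i j i1 i2 = low_weyl i j i3 i4].

Lemma low_weyl_anti i j k l : low_weyl j i k l = - low_weyl i j k l.
Proof. by rewrite /low_weyl Lanti1; ring. Qed.

Ltac weyl_simp := rewrite /low_weyl /low_scalar /low_ricci /gram4 /=;
  rewrite !Lsimp; rewrite !Lpair; rewrite ?bianchi1423;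
  rewrite /psi0 /psi1 /psi2 /psi3 /psi4 ?Lpair ?bianchi1423.

(** The table below is the block form of the Weyl tensor: self-dual and anti-self-dual index pairs
    do not mix. The pairs 14 and 23 and the sum of 12 and 34 are anti-self-dual, so the first two
    rows vanish and the rows 12 and 34 are opposite. *)
Let sd_values i j x y z := [/\ low_weyl i j i2 i4 = x, low_weyl i j i1 i3 = y
  & low_weyl i j i1 i2 - low_weyl i j i3 i4 = z].

Let sd_values24 : sd_values i2 i4 (psi0) (- psi2 / 6) (psi1 / 2).
Proof. by split; weyl_simp; field. Qed.

Let sd_values13 : sd_values i1 i3 (- psi2 / 6) (psi4) (psi3 / 2).
Proof. by split; weyl_simp; field. Qed.

Let sd_values12 : sd_values i1 i2 (psi1 / 4) (psi3 / 4) (psi2 / 3).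
Proof. by split; weyl_simp; field. Qed.

Let sd_values34 : sd_values i3 i4 (- psi1 / 4) (- psi3 / 4) (- psi2 / 3).
Proof. by split; weyl_simp; field. Qed.

Let sd_values14 : sd_values i1 i4 (0) (0) (0).
Proof. by split; weyl_simp; field. Qed.

Let sd_values23 : sd_values i2 i3 (0) (0) (0).
Proof. by split; weyl_simp; field. Qed.

Let asd_anti i j : asd_components i j -> asd_components j i.
Proof.
by move=> [e1 e2 e3]; rewrite /asd_components !(low_weyl_anti i j) e1 e2 e3 !oppr0.
Qed.

(** The rows 24 and 13 of the table already contain all five scalars and give the direct
    implication; the converse reads all six rows and completes them by antisymmetry. *)
Lemma asd_componentsP : (forall i j, asd_components i j) <->
  [/\ psi0 = 0, psi1 = 0, psi2 = 0, psi3 = 0 & psi4 = 0].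
Proof.
split=> [asd|[w0 w1 w2 w3 w4]].
  have [e1 e2 e3] := sd_values24; have [_ f2 f3] := sd_values13.
  have [a1 a2 a3] := asd i2 i4; have [_ b2 b3] := asd i1 i3.
  move: a1 a2 e3 b2 f3; rewrite a3 b3 !subrr e1 e2 f2 => -> c2 c1 -> c3.
  have n6 : (6 : C) != 0 by rewrite pnatr_eq0.
  have div0 (x y : C) : y != 0 -> 0 = x / y -> x = 0.
    by move=> y0 /esym/eqP; rewrite mulf_eq0 invr_eq0 (negbTE y0) orbF => /eqP.
  split => //; [exact: div0 n2 c1| |exact: div0 n2 c3].
  by apply/eqP; rewrite -oppr_eq0; apply/eqP/(div0 _ 6).
have asd i j x y z : x = 0 -> y = 0 -> z = 0 -> sd_values i j x y z ->
    asd_components i j.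
  move=> -> -> -> [e1 e2 /eqP e3]; split => //.
  by apply/eqP; rewrite -subr_eq0.
have diag i : asd_components i i.
  suff wii k l : low_weyl i i k l = 0 by split; rewrite !wii.
  apply: (mulfI n2); rewrite mulr0 mulr_natl mulr2n.
  by rewrite {1}low_weyl_anti addNr.
have z (x : C) : 0 / x = 0 by rewrite mul0r.
have a12 : asd_components i1 i2.
  by apply: asd sd_values12; rewrite ?w1 ?w2 ?w3 z.
have a34 : asd_components i3 i4.
  by apply: asd sd_values34; rewrite ?w1 ?w2 ?w3 oppr0 z.
have a13 : asd_components i1 i3.
  by apply: asd sd_values13; rewrite ?w2 ?w3 ?oppr0 ?z.
have a24 : asd_components i2 i4.
  by apply: asd sd_values24; rewrite ?w1 ?w2 ?oppr0 ?z.
have a14 : asd_components i1 i4 by apply: asd sd_values14.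
have a23 : asd_components i2 i3 by apply: asd sd_values23.
have I4 k : [\/ k = i1, k = i2, k = i3 | k = i4].
  case: k => -[|[|[|[|//]]]] lt4; [apply: Or41|apply: Or42|apply: Or43|apply: Or44];
  exact: val_inj.
by move=> i j; case: (I4 i) => ->; case: (I4 j) => -> //; apply: asd_anti.
Qed.

Lemma quartic_eq0 (a b c d e : C) :
  (forall z, a + z * b + z ^+ 2 * c + z ^+ 3 * d + z ^+ 4 * e = 0) ->
  [/\ a = 0, b = 0, c = 0, d = 0 & e = 0].
Proof.
move=> H; have a0 : a = 0 by rewrite -[RHS](H 0); ring.
have n0 k (x : C) : k.+1%:R * x = 0 -> x = 0.
  by move/eqP; rewrite mulf_eq0 pnatr_eq0 => /eqP.
have e0 : e = 0.
  (* [n0] takes a predecessor: 23 stands for the factor 24 in the fourth central difference of q at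
     0, which isolates e. The third difference, with factor 12, isolates d in the same way. *)
  apply: (n0 23); pose q z := a + z * b + z ^+ 2 * c + z ^+ 3 * d + z ^+ 4 * e.
  have -> : 24 * e = q 2 + q (- 2) - 4 * (q 1 + q (- 1)) + 6 * a by rewrite /q; ring.
  by rewrite /q !H a0; ring.
have d0 : d = 0.
  apply: (n0 11); pose q z := a + z * b + z ^+ 2 * c + z ^+ 3 * d + z ^+ 4 * e.
  have -> : 12 * d = q 2 - q (- 2) - 2 * (q 1 - q (- 1)) by rewrite /q; ring.
  by rewrite /q !H; ring.
have c0 : c = 0.
  apply: (n0 1); pose q z := a + z * b + z ^+ 2 * c + z ^+ 3 * d + z ^+ 4 * e.
  have -> : 2 * c = q 1 + q (- 1) - 2 * a - 2 * e by rewrite /q; ring.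
  by rewrite /q !H a0 e0; ring.
by split=> //; rewrite -[RHS](H 1) a0 c0 d0 e0; ring.
Qed.

End WeylAlgebra.

Lemma low_weyl_anti2 (C : numFieldType)
    (L : 'I_4 -> 'I_4 -> 'I_4 -> 'I_4 -> C) i j k l :
  (forall i j k l, L i j l k = - L i j k l) ->
  low_weyl L i j l k = - low_weyl L i j k l.
Proof. by move=> La; rewrite /low_weyl La; ring. Qed.

(** * Forms in a coframe *)

Section Frame.
Variables (R : realType) (n : nat) (T : 'M[R[i]]_n).
Hypothesis uT : T \in unitmx.
Implicit Types w : kform R n 2.

Definition frame_comp w (k l : 'I_n) : R[i] :=
  \sum_a \sum_b w (pairi a b) * invmx T a k * invmx T b l.

Let frame_compE w k l : frame_comp w k l =
  ((invmx T)^T *m (\matrix_(a, b) w (pairi a b)) *m invmx T) k l.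
Proof.
rewrite mxE /frame_comp exchange_big; apply: eq_bigr => b _.
rewrite mxE mulr_suml; apply: eq_bigr => a _; rewrite !mxE.
by congr (_ * _); rewrite mulrC.
Qed.

Lemma frame_comp_expand w x y :
  \sum_k \sum_l frame_comp w k l * T k x * T l y = w (pairi x y).
Proof.
transitivity ((T^T *m ((invmx T)^T *m (\matrix_(a, b) w (pairi a b)) *m invmx T)
                *m T) x y).
  rewrite mxE exchange_big; apply: eq_bigr => l _; rewrite mxE mulr_suml.
  apply: eq_bigr => k _; rewrite frame_compE [T^T _ _]mxE.
  by congr (_ * _); rewrite mulrC.
by rewrite -!mulmxA mulVmx // mulmx1 mulmxA -trmx_mul mulVmx // trmx1 mul1mx mxE.
Qed.

Lemma frame_decomp w I : (forall a b, w (pairi b a) = - w (pairi a b)) ->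
  w I = \sum_k \sum_l
    2^-1 * (frame_comp w k l * wedge11 (row k T) (row l T) I).
Proof.
move=> wanti.
(* Antisymmetrising before the expansion makes each term of the double sum an exterior product. *)
transitivity (2^-1 * (w (pairi (I 0) (I 1)) - w (pairi (I 1) (I 0)))).
  rewrite (wanti (I 0)) opprK pairi_eta; apply: (@mulfI _ 2).
    by rewrite pnatr_eq0.
  by rewrite mulrA divff ?pnatr_eq0 // mul1r mulrDl mul1r.
rewrite -!frame_comp_expand -sumrB mulr_sumr; apply: eq_bigr => k _.
rewrite -sumrB mulr_sumr; apply: eq_bigr => l _; congr (_ * _).
by rewrite wedge11E !mxE; ring.
Qed.

Lemma frame_comp_wedge11 i j k l : frame_comp (wedge11 (row i T) (row j T)) k l =
  (i == k)%:R * (j == l)%:R - (i == l)%:R * (j == k)%:R.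
Proof.
have TV x y : \sum_a T x a * invmx T a y = (x == y)%:R.
  by have := mulmxV uT => /matrixP/(_ x y); rewrite !mxE.
rewrite [X in _ - X]mulrC -!TV /frame_comp !mulr_suml -sumrB; apply: eq_bigr => a _.
rewrite [in RHS]mulr_sumr [X in _ - X]mulr_sumr -sumrB; apply: eq_bigr => b _.
by rewrite wedge11E !mxE /pairi /=; ring.
Qed.

Lemma frame_compD w w' k l :
  frame_comp (fun I => w I + w' I) k l = frame_comp w k l + frame_comp w' k l.
Proof.
rewrite /frame_comp -big_split; apply: eq_bigr => a _.
by rewrite -big_split; apply: eq_bigr => b _ /=; rewrite !mulrDl.
Qed.

Lemma frame_compZ x w k l :
  frame_comp (fun I => x * w I) k l = x * frame_comp w k l.
Proof.
rewrite /frame_comp mulr_sumr; apply: eq_bigr => a _.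
by rewrite mulr_sumr; apply: eq_bigr => b _ /=; rewrite !mulrA.
Qed.

Lemma frame_comp_sum (J : finType) (w : J -> kform R n 2) k l :
  frame_comp (fun I => \sum_j w j I) k l = \sum_j frame_comp (w j) k l.
Proof.
rewrite /frame_comp [RHS]exchange_big; apply: eq_bigr => a _ /=.
by rewrite [RHS]exchange_big; apply: eq_bigr => b _ /=; rewrite !mulr_suml.
Qed.

End Frame.

(** * The curvature of the Levi-Civita connection *)

Lemma sum4 (U : nmodType) (F : 'I_4 -> U) :
  \sum_k F k = F i1 + F i2 + F i3 + F i4.
Proof.
rewrite !big_ord_recl big_ord0 addr0 !addrA.
by congr (F _ + F _ + F _ + F _); apply: val_inj.
Qed.

Lemma ord4P (k : 'I_4) : [\/ k = i1, k = i2, k = i3 | k = i4].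
Proof.
case: k => -[|[|[|[|//]]]] lt4; [apply: Or41|apply: Or42|apply: Or43|apply: Or44];
exact: val_inj.
Qed.

Lemma null_gramE (R : realType) i j : null_gram R i j = gram4 R[i] i j.
Proof.
by case: (ord4P i) => ->; case: (ord4P j) => ->; rewrite !mxE /= /gram4 /=; ring.
Qed.

(* X lies in the Lie algebra of the orthogonal group of null_gram, indices of X
   being placed as in Gamma^i_j. *)
Definition so_relations (U : zmodType) (X : 'I_4 -> 'I_4 -> U) : Prop :=
  [/\ [/\ X i1 i2 = 0, X i2 i1 = 0, X i3 i4 = 0 & X i4 i3 = 0],
      X i2 i2 = - X i1 i1 /\ X i4 i4 = - X i3 i3
    & [/\ X i1 i4 = X i3 i2, X i4 i1 = X i2 i3, X i1 i3 = X i4 i2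
        & X i3 i1 = X i2 i4]].

Lemma so_relations_lower (R : realType) (X : 'I_4 -> 'I_4 -> R[i]) i j :
  so_relations X ->
  \sum_m null_gram R j m * X m i = - \sum_m null_gram R i m * X m j.
Proof.
move=> [[x12 x21 x34 x43] [x22 x44] [x14 x41 x13 x31]].
rewrite !sum4 !null_gramE.
case: (ord4P i) => ->; case: (ord4P j) => ->; rewrite /gram4 /=;
by rewrite ?x12 ?x21 ?x34 ?x43 ?x22 ?x44 ?x14 ?x41 ?x13 ?x31; ring.
Qed.

Lemma lower_so_relations (R : realType) (X : 'I_4 -> 'I_4 -> R[i]) :
  (forall i j, \sum_m null_gram R i m * X m j + \sum_m null_gram R j m * X m i = 0) ->
  so_relations X.
Proof.
move=> H.
pose S i j := \sum_m null_gram R i m * X m j + \sum_m null_gram R j m * X m i.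
(* Each relation is one entry of S. The factor c undoes the entries 1/2 and -1/2 of the Gram matrix;
   on the diagonal of S the two sums coincide, which leaves only a sign. *)
have conclude i j c y z : y - z = c * S i j -> y = z.
  by rewrite /S H mulr0 => /eqP; rewrite subr_eq0 => /eqP.
split; [split|split|split].
- by apply: (conclude i2 i2 1); rewrite /S !sum4 !null_gramE /gram4 /=; field.
- by apply: (conclude i1 i1 1); rewrite /S !sum4 !null_gramE /gram4 /=; field.
- by apply: (conclude i4 i4 (- 1)); rewrite /S !sum4 !null_gramE /gram4 /=; field.
- by apply: (conclude i3 i3 (- 1)); rewrite /S !sum4 !null_gramE /gram4 /=; field.
- by apply: (conclude i1 i2 2); rewrite /S !sum4 !null_gramE /gram4 /=; field.
- by apply: (conclude i3 i4 (- 2)); rewrite /S !sum4 !null_gramE /gram4 /=; field.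
- by apply: (conclude i2 i4 2); rewrite /S !sum4 !null_gramE /gram4 /=; field.
- by apply: (conclude i1 i3 (- 2)); rewrite /S !sum4 !null_gramE /gram4 /=; field.
- by apply: (conclude i2 i3 2); rewrite /S !sum4 !null_gramE /gram4 /=; field.
- by apply: (conclude i1 i4 (- 2)); rewrite /S !sum4 !null_gramE /gram4 /=; field.
Qed.

(* The first Bianchi identity, abstracted to a point: dt and dG are the partial
   derivatives of the coframe and of the connection. *)
Lemma bianchi_pointwise (C : comPzRingType) (n : nat) (T : finType)
    (t : T -> 'I_n -> C) (dt : T -> 'I_n -> 'I_n -> C)
    (G : T -> 'I_n -> C) (Gm : T -> T -> 'I_n -> C)
    (dG : T -> 'I_n -> 'I_n -> C) (a b c : 'I_n) :
  let dtau j z x y := dG j z x * t j y + G j x * dt j z y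
                      - (dG j z y * t j x + G j y * dt j z x) in
  let Om j x y := dG j x y - dG j y x + \sum_k (G k x * Gm k j y - G k y * Gm k j x) in
  (forall j x y, dt j x y - dt j y x =
     - \sum_k (Gm j k x * t k y - Gm j k y * t k x)) ->
  \sum_j dtau j a b c + \sum_j dtau j b c a + \sum_j dtau j c a b = 0 ->
  \sum_j Om j a b * t j c + \sum_j Om j b c * t j a + \sum_j Om j c a * t j b = 0.
Proof.
(* S0 expresses d(d theta^i) = 0, with d theta^i replaced by -Gamma^i_j /\ theta^j. *)
move=> dtau Om dtE; set S := (X in X = 0 -> _) => S0; rewrite -[RHS]S0 /S {S S0}.
have quad x y z : \sum_j (\sum_k (G k x * Gm k j y - G k y * Gm k j x)) * t j z =
   \sum_j G j x * \sum_k Gm j k y * t k z - \sum_j G j y * \sum_k Gm j k x * t k z.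
  under eq_bigr do rewrite mulr_suml.
  rewrite exchange_big -sumrB; apply: eq_bigr => k _.
  rewrite !mulr_sumr -sumrB; apply: eq_bigr => j _; ring.
rewrite -!big_split /=.
have lhs j : Om j a b * t j c + Om j b c * t j a + Om j c a * t j b =
  ((dG j a b - dG j b a) * t j c + (dG j b c - dG j c b) * t j a
   + (dG j c a - dG j a c) * t j b)
  + ((\sum_k (G k a * Gm k j b - G k b * Gm k j a)) * t j c
  + (\sum_k (G k b * Gm k j c - G k c * Gm k j b)) * t j a
  + (\sum_k (G k c * Gm k j a - G k a * Gm k j c)) * t j b).
  by rewrite /Om; ring.
have rhs j : dtau j a b c + dtau j b c a + dtau j c a b =
  ((dG j a b - dG j b a) * t j c + (dG j b c - dG j c b) * t j a
   + (dG j c a - dG j a c) * t j b)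
  - (G j a * (dt j b c - dt j c b) + G j b * (dt j c a - dt j a c)
     + G j c * (dt j a b - dt j b a)).
  by rewrite /dtau; ring.
rewrite (eq_bigr _ (fun j _ => lhs j)) (eq_bigr _ (fun j _ => rhs j)).
rewrite !big_split /= ![in LHS]quad sumrN; congr (_ + _).
(* The torsion equation turns Gamma /\ d theta into -Gamma /\ Gamma /\ theta, which matches the
   quadratic part of the curvature on the other side. *)
have dtG x y z : \sum_j G j x * (dt j y z - dt j z y) =
   - (\sum_j G j x * \sum_k Gm j k y * t k z - \sum_j G j x * \sum_k Gm j k z * t k y).
  rewrite -sumrB -sumrN; apply: eq_bigr => j _; rewrite dtE mulrN.
  by rewrite sumrB mulrBr.
rewrite !big_split /= !dtG.
ring.
Qed.

Section LeviCivita.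
Variables (R : realType) (V : set 'rV[R]_4) (th : 'rV[R]_4 -> 'M[R[i]]_4).
Variable Gam : 'I_4 -> 'I_4 -> 'rV[R]_4 -> 'rV[R[i]]_4.
Hypotheses (openV : open V) (sth : csmooth_mx V th).
Hypothesis lc : levi_civita V (fun=> null_gram R) th Gam.

Let sGam i j a : csmooth V (fun u => Gam i j u 0 a).
Proof. by have [sG _ _] := lc; exact: sG. Qed.

(** The Gram matrix of a null cotetrad is constant and A = 0, so the metric equation says that the
    lowered connection forms are antisymmetric. *)
Lemma levi_civita_so u : V u -> so_relations (fun i j => Gam i j u).
Proof.
move=> Vu; suff so c : so_relations (fun i j => Gam i j u 0 c).
  have [[a1 a2 a3 a4] [b1 b2] [c1 c2 c3 c4]] :
      [/\ [/\ forall c, Gam i1 i2 u 0 c = 0, forall c, Gam i2 i1 u 0 c = 0,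
              forall c, Gam i3 i4 u 0 c = 0 & forall c, Gam i4 i3 u 0 c = 0],
      (forall c, Gam i2 i2 u 0 c = - Gam i1 i1 u 0 c) /\
      (forall c, Gam i4 i4 u 0 c = - Gam i3 i3 u 0 c)
    & [/\ forall c, Gam i1 i4 u 0 c = Gam i3 i2 u 0 c,
          forall c, Gam i4 i1 u 0 c = Gam i2 i3 u 0 c,
          forall c, Gam i1 i3 u 0 c = Gam i4 i2 u 0 c
        & forall c, Gam i3 i1 u 0 c = Gam i2 i4 u 0 c]].
    by split; split; move=> c; have [[? ? ? ?] [? ?] [? ? ? ?]] := so c.
  by split; split; apply/rowP => c; rewrite ?mxE.
apply: lower_so_relations => i j; have [_ /(_ u i j Vu)/rowP/(_ c) + _] := lc.
rewrite !mxE cpartial_cst sub0r !summxE => /eqP.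
rewrite mulr0 oppr0 -opprD oppr_eq0 => /eqP e; rewrite -[RHS]e.
by congr (_ + _); apply: eq_bigr => k _; rewrite !mxE.
Qed.

Lemma curvature_form_pair i j u (I : 'I_2 -> 'I_4) :
  curvature_form Gam i j u I = d1 (Gam i j) u I +
    \sum_k (Gam i k u 0 (I 0) * Gam k j u 0 (I 1) -
            Gam i k u 0 (I 1) * Gam k j u 0 (I 0)).
Proof. by congr (_ + _); apply: eq_bigr => k _; rewrite wedge11E. Qed.

Lemma d1_so u I : V u -> so_relations (fun i j => d1 (Gam i j) u I).
Proof.
move=> Vu.
(* Every relation has the form Gam i j = x Gam k l on the open set V, with x equal to 0, 1 or -1,
   and so passes to exterior derivatives. *)
have ext i j (x : R[i]) k l : (forall v, V v -> Gam i j v = x *: Gam k l v) ->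
    d1 (Gam i j) u I = x * d1 (Gam k l) u I.
  move=> e; rewrite /d1 mulrBr; congr (_ - _).
    rewrite (eq_cpartial openV _ (g := fun v => x * Gam k l v 0 (I 1))) //.
      by rewrite cpartialZ //; exact: csmooth_cderivable Vu _.
    by move=> v /e ->; rewrite mxE.
  rewrite (eq_cpartial openV _ (g := fun v => x * Gam k l v 0 (I 0))) //.
    by rewrite cpartialZ //; exact: csmooth_cderivable Vu _.
  by move=> v /e ->; rewrite mxE.
split; [split|split|split].
- rewrite (ext _ _ 0 i1 i1) ?mul0r // => v /levi_civita_so[[->]].
  by rewrite scale0r.
- rewrite (ext _ _ 0 i1 i1) ?mul0r // => v /levi_civita_so[[_ ->]].
  by rewrite scale0r.
- rewrite (ext _ _ 0 i1 i1) ?mul0r // => v /levi_civita_so[[_ _ ->]].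
  by rewrite scale0r.
- rewrite (ext _ _ 0 i1 i1) ?mul0r // => v /levi_civita_so[[_ _ _ ->]].
  by rewrite scale0r.
- rewrite (ext _ _ (-1) i1 i1) ?mulN1r // => v /levi_civita_so[_ [->]].
  by rewrite scaleN1r.
- rewrite (ext _ _ (-1) i3 i3) ?mulN1r // => v /levi_civita_so[_ [_ ->]].
  by rewrite scaleN1r.
- rewrite (ext _ _ 1 i3 i2) ?mul1r // => v /levi_civita_so[_ _ [->]].
  by rewrite scale1r.
- rewrite (ext _ _ 1 i2 i3) ?mul1r // => v /levi_civita_so[_ _ [_ ->]].
  by rewrite scale1r.
- rewrite (ext _ _ 1 i4 i2) ?mul1r // => v /levi_civita_so[_ _ [_ _ ->]].
  by rewrite scale1r.
- rewrite (ext _ _ 1 i2 i4) ?mul1r // => v /levi_civita_so[_ _ [_ _ _ ->]].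
  by rewrite scale1r.
Qed.

(** The quadratic part stays in the orthogonal Lie algebra because the algebra is closed under
    brackets; here this is checked entry by entry. *)
Lemma curvature_form_so u I : V u ->
  so_relations (fun i j => curvature_form Gam i j u I).
Proof.
move=> Vu.
have [[d12 d21 d34 d43] [d22 d44] [d14 d41 d13 d31]] := d1_so I Vu.
have [[x12 x21 x34 x43] [x22 x44] [x14 x41 x13 x31]] := levi_civita_so Vu.
split; [split|split|split]; rewrite !curvature_form_pair ?d12 ?d21 ?d34 ?d43;
rewrite ?d22 ?d44 ?d14 ?d41 ?d13 ?d31 !sum4 ?x12 ?x21 ?x34 ?x43 ?x22 ?x44;
by rewrite ?x14 ?x41 ?x13 ?x31 ?mxE; ring.
Qed.

Lemma curvature_form_anti i j u a b :
  curvature_form Gam i j u (pairi b a) = - curvature_form Gam i j u (pairi a b).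
Proof.
rewrite !curvature_form_pair opprD -sumrN; congr (_ + _); first by rewrite /d1 opprB.
by apply: eq_bigr => k _; rewrite opprB.
Qed.

Let thE a b v : row a (th v) 0 b = th v a b. Proof. by rewrite mxE. Qed.

Lemma d1_coframe u i a b : V u ->
  cpartial a (fun v => th v i b) u - cpartial b (fun v => th v i a) u =
  - \sum_j (Gam i j u 0 a * th u j b - Gam i j u 0 b * th u j a).
Proof.
move=> Vu; have [_ _ /(_ u i (pairi a b) Vu)] := lc.
have E c d : cpartial c (fun v => row i (th v) 0 d) u = cpartial c (fun v => th v i d) u.
  by congr cpartial; apply/funext => v; rewrite thE.
rewrite /d1 /= !E => ->; congr (- _); apply: eq_bigr => j _.
by rewrite wedge11E !thE.
Qed.

(** The second partial derivatives of the coframe cancel in the cyclic sum that expresses d(d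
    theta^i) = 0. *)
Lemma bianchi_form u i a b c : V u ->
  \sum_j curvature_form Gam i j u (pairi a b) * th u j c +
  \sum_j curvature_form Gam i j u (pairi b c) * th u j a +
  \sum_j curvature_form Gam i j u (pairi c a) * th u j b = 0.
Proof.
move=> Vu.
have dG j x y : cderivable (fun v => Gam i j v 0 x) u y.
  exact: csmooth_cderivable Vu _.
have dt j x y : cderivable (fun v => th v j x) u y.
  by apply: csmooth_cderivable Vu _; exact: sth.
have := @bianchi_pointwise R[i] 4 'I_4 (fun j x => th u j x)
  (fun j z x => cpartial z (fun v => th v j x) u)
  (fun j x => Gam i j u 0 x) (fun j k x => Gam j k u 0 x)
  (fun j z x => cpartial z (fun v => Gam i j v 0 x) u) a b c.
move=> /(_ (fun j x y => d1_coframe j x y Vu)) /= H.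
have curvE j x y : curvature_form Gam i j u (pairi x y) =
    cpartial x (fun v => Gam i j v 0 y) u - cpartial y (fun v => Gam i j v 0 x) u +
    \sum_k (Gam i k u 0 x * Gam k j u 0 y - Gam i k u 0 y * Gam k j u 0 x).
  by rewrite curvature_form_pair.
rewrite -[RHS]H; first by congr (_ + _ + _); apply: eq_bigr => j _; rewrite curvE.
have ddt z x y : \sum_j (cpartial z (fun v => Gam i j v 0 x) u * th u j y +
      Gam i j u 0 x * cpartial z (fun v => th v j y) u -
      (cpartial z (fun v => Gam i j v 0 y) u * th u j x +
      Gam i j u 0 y * cpartial z (fun v => th v j x) u)) =
    cpartial z (cpartial y (fun v => th v i x)) u
    - cpartial z (cpartial x (fun v => th v i y)) u.
  have st j w : csmooth V (fun v => th v j w) by exact: sth.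
  have dct w r : cderivable (cpartial w (fun v => th v i r)) u z.
    by apply: csmooth_cderivable Vu _; exact: csmooth_cpartial.
  rewrite -cpartialN // -cpartialD //; last exact: cderivableN.
  (* The structure equation [d1_coframe] holds on all of V and may therefore be differentiated at
     u. *)
  rewrite (eq_cpartial openV _ Vu (g := fun v => \sum_j
    (Gam i j v 0 x * th v j y + - (Gam i j v 0 y * th v j x)))); last first.
    by move=> v Vv; rewrite -opprB d1_coframe // opprK.
  have dM j w r : cderivable (fun v => Gam i j v 0 w * th v j r) u z.
    exact: cderivableM.
  rewrite cpartial_sum; last by move=> j; apply: cderivableD => //; exact: cderivableN.
  apply: eq_bigr => j _.
  rewrite cpartialD //; last exact: cderivableN.
  by rewrite cpartialN // !cpartialM.
rewrite !ddt.
have st j w : csmooth V (fun v => th v j w) by exact: sth.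
rewrite (cpartial_comm openV a c Vu (st i b)) (cpartial_comm openV b a Vu (st i c)).
by rewrite (cpartial_comm openV c b Vu (st i a)) !addrA !subrK subrr.
Qed.

End LeviCivita.

(** * Riemann, Ricci and Weyl tensors in a null cotetrad *)

Section LeviCivitaWeyl.
Variables (R : realType) (V : set 'rV[R]_4) (th : 'rV[R]_4 -> 'M[R[i]]_4).
Variable Gam : 'I_4 -> 'I_4 -> 'rV[R]_4 -> 'rV[R[i]]_4.
Hypotheses (openV : open V) (sth : csmooth_mx V th).
Hypothesis uth : forall u, V u -> th u \in unitmx.
Hypothesis lc : levi_civita V (fun=> null_gram R) th Gam.
Variable u : 'rV[R]_4.
Hypothesis Vu : V u.

Let Rup := riemann_up th Gam u.
Let Rlow := riemann (fun=> null_gram R) th Gam u.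

Lemma riemann_upE i j k l :
  Rup i j k l = frame_comp (th u) (curvature_form Gam i j u) k l.
Proof. by []. Qed.

Lemma riemann_up_so k l : so_relations (fun i j => Rup i j k l).
Proof.
have compC x (w w' : kform R 4 2) : (forall I, w I = x * w' I) ->
    frame_comp (th u) w k l = x * frame_comp (th u) w' k l.
  by move=> e; rewrite -frame_compZ; congr frame_comp; apply/funext.
have so I := curvature_form_so openV lc I Vu.
split; [split|split|split]; rewrite !riemann_upE.
- rewrite (compC 0 _ (fun=> 0)) ?mul0r // => I.
  by have [[->]] := so I; rewrite ?mul0r.
- rewrite (compC 0 _ (fun=> 0)) ?mul0r // => I.
  by have [[_ ->]] := so I; rewrite ?mul0r.
- rewrite (compC 0 _ (fun=> 0)) ?mul0r // => I.
  by have [[_ _ ->]] := so I; rewrite ?mul0r.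
- rewrite (compC 0 _ (fun=> 0)) ?mul0r // => I.
  by have [[_ _ _ ->]] := so I; rewrite ?mul0r.
- rewrite (compC (-1) _ (curvature_form Gam i1 i1 u)) ?mulN1r // => I.
  by have [_ [-> _]] := so I; rewrite mulN1r.
- rewrite (compC (-1) _ (curvature_form Gam i3 i3 u)) ?mulN1r // => I.
  by have [_ [_ ->]] := so I; rewrite mulN1r.
- rewrite (compC 1 _ (curvature_form Gam i3 i2 u)) ?mul1r // => I.
  by have [_ _ [-> _ _ _]] := so I; rewrite mul1r.
- rewrite (compC 1 _ (curvature_form Gam i2 i3 u)) ?mul1r // => I.
  by have [_ _ [_ -> _ _]] := so I; rewrite mul1r.
- rewrite (compC 1 _ (curvature_form Gam i4 i2 u)) ?mul1r // => I.
  by have [_ _ [_ _ -> _]] := so I; rewrite mul1r.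
- rewrite (compC 1 _ (curvature_form Gam i2 i4 u)) ?mul1r // => I.
  by have [_ _ [_ _ _ ->]] := so I; rewrite mul1r.
Qed.

Lemma riemann_anti1 i j k l : Rlow j i k l = - Rlow i j k l.
Proof. exact: so_relations_lower (riemann_up_so k l). Qed.

Lemma riemann_up_anti2 i j k l : Rup i j l k = - Rup i j k l.
Proof.
rewrite !riemann_upE /frame_comp exchange_big -sumrN; apply: eq_bigr => a _.
rewrite -sumrN; apply: eq_bigr => b _.
by rewrite (curvature_form_anti Gam i j u a b) !mulNr mulrAC.
Qed.

Lemma riemann_anti2 i j k l : Rlow i j l k = - Rlow i j k l.
Proof.
rewrite /Rlow /riemann -sumrN; apply: eq_bigr => m _.
by rewrite -mulrN -riemann_up_anti2.
Qed.

Lemma riemann_up_bianchi i j k l : Rup i j k l + Rup i k l j + Rup i l j k = 0.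
Proof.
pose e a m := invmx (th u) a m.
pose S x y w := \sum_j curvature_form Gam i j u (pairi x y) * th u j w.
have TV m p : \sum_a th u m a * e a p = (m == p)%:R.
  by have := mulmxV (uth Vu) => /matrixP/(_ m p); rewrite !mxE.
have contract p q m : \sum_a \sum_b (\sum_c S a b c * e c m) * e a p * e b q
    = Rup i m p q.
  rewrite riemann_upE; apply: eq_bigr => a _; apply: eq_bigr => b _.
  congr (_ * _ * _); rewrite /S; under eq_bigr do rewrite mulr_suml.
  rewrite exchange_big (bigD1 m) //= [X in _ + X]big1 => [|n nm].
    rewrite addr0; under eq_bigr do rewrite -mulrA.
    by rewrite -mulr_sumr TV eqxx mulr1.
  under eq_bigr do rewrite -mulrA.
  by rewrite -mulr_sumr TV (negbTE nm) mulr0.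
have flat p q m : Rup i m p q = \sum_a \sum_b \sum_c S a b c * (e a p * e b q * e c m).
  rewrite -contract; apply: eq_bigr => a _; apply: eq_bigr => b _.
  by rewrite !mulr_suml; apply: eq_bigr => c _; ring.
have S0 a b c : S a b c + S b c a + S c a b = 0.
  exact: (bianchi_form openV sth lc i a b c Vu).
(* Cyclic renaming of the summation indices gives the three sums the common factor e a j * e b k * e
   c l, next to which the coordinate identity S0 appears. *)
have rot (f : 'I_4 -> 'I_4 -> 'I_4 -> R[i]) :
    \sum_a \sum_b \sum_c f a b c = \sum_a \sum_b \sum_c f b c a.
  rewrite [RHS]exchange_big; apply: eq_bigr => a _.
  by rewrite [RHS]exchange_big.
rewrite (flat k l j) (flat l j k) (flat j k l) rot.
rewrite [X in _ + X + _](rot (fun a b c => S a b c * _)) /=.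
rewrite [X in _ + X + _](rot (fun a b c => S b c a * _)) /=.
rewrite -!big_split big1 //= => a _; rewrite -!big_split big1 //= => b _.
rewrite -!big_split big1 //= => c _.
rewrite -[RHS](mul0r (e a j * e b k * e c l)) -(S0 a b c); ring.
Qed.

Lemma riemann_bianchi i j k l : Rlow i j k l + Rlow i k l j + Rlow i l j k = 0.
Proof.
rewrite /Rlow /riemann -!big_split big1 //= => m _.
by rewrite -!mulrDr riemann_up_bianchi mulr0.
Qed.

Lemma riemann_up_lower j k l :
  [/\ Rup i1 j k l = 2 * Rlow i2 j k l, Rup i2 j k l = 2 * Rlow i1 j k l,
      Rup i3 j k l = - 2 * Rlow i4 j k l & Rup i4 j k l = - 2 * Rlow i3 j k l].
Proof.
rewrite /Rup /Rlow /riemann; move: (riemann_up th Gam u) => f.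
by split; rewrite sum4 !null_gramE /gram4 /=; field.
Qed.

Let ricciE j l : ricci th Gam u j l = low_ricci Rlow j l.
Proof.
rewrite /ricci sum4 -/Rup; have [-> _ _ _] := riemann_up_lower j i1 l.
have [_ -> _ _] := riemann_up_lower j i2 l; have [_ _ -> _] := riemann_up_lower j i3 l.
have [_ _ _ ->] := riemann_up_lower j i4 l.
by rewrite /low_ricci; ring.
Qed.

Lemma invmx_null_gram : invmx (null_gram R) = 4 *: null_gram R.
Proof.
have hh : null_gram R *m (4 *: null_gram R) = 1%:M.
  apply/matrixP => i j; rewrite !mxE sum4 !(mxE, null_gramE).
  by case: (ord4P i) => ->; case: (ord4P j) => ->; rewrite /gram4 /=; field.
have [u1 _] := mulmx1_unit hh.
by rewrite -[RHS]mul1mx -(mulVmx u1) -mulmxA hh mulmx1.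
Qed.

Let scalarE : scalar_curvature (fun=> null_gram R) th Gam u = low_scalar Rlow.
Proof.
rewrite /scalar_curvature /low_scalar.
have -> : ricci th Gam u = low_ricci Rlow.
  by apply/funext => j; apply/funext => l; exact: ricciE.
move: (low_ricci Rlow) => f.
have invE j l : invmx (null_gram R) j l = 4 * gram4 R[i] j l.
  by rewrite invmx_null_gram mxE null_gramE.
by rewrite !sum4 !invE /gram4 /=; field.
Qed.

Lemma weyl_tensorE i j k l :
  weyl_tensor (fun=> null_gram R) th Gam u i j k l = low_weyl Rlow i j k l.
Proof. by rewrite /weyl_tensor scalarE !ricciE !null_gramE. Qed.

(** The double sum meets each unordered pair of indices twice, which the factor 1/2 in [weyl_2form]
    compensates. *)
Lemma frame_comp_weyl_2form i j p q :
  frame_comp (th u) (weyl_2form (fun=> null_gram R) th Gam u i j) p q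
  = low_weyl Rlow i j p q.
Proof.
rewrite /weyl_2form frame_compZ frame_comp_sum.
under eq_bigr do rewrite frame_comp_sum.
under eq_bigr do under eq_bigr do
  rewrite frame_compZ (frame_comp_wedge11 (uth Vu)) weyl_tensorE.
apply: (@mulfI _ 2); first by rewrite pnatr_eq0.
rewrite mulrA divff ?pnatr_eq0 // mul1r mulrDl mul1r.
rewrite -{1}[low_weyl _ _ _ _ _]opprK -(low_weyl_anti2 _ _ _ _ riemann_anti2).
have pick (f : 'I_4 -> 'I_4 -> R[i]) x y :
    \sum_k \sum_l f k l * ((k == x)%:R * (l == y)%:R) = f x y.
  rewrite (bigD1 x) //= [X in _ + X]big1 => [|k kx].
    rewrite addr0 (bigD1 y) //= [X in _ + X]big1 => [|l ly].
      by rewrite !eqxx !mulr1 addr0.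
    by rewrite (negbTE ly) !mulr0.
  by rewrite big1 // => l _; rewrite (negbTE kx) mul0r mulr0.
rewrite -(pick (low_weyl Rlow i j) p q) -(pick (low_weyl Rlow i j) q p).
rewrite addrC -sumrB; apply: eq_bigr => k _; rewrite -sumrB; apply: eq_bigr => l _.
by rewrite mulrBr.
Qed.

Lemma asd_weyl_2formP i j :
  asd_2form (th u) (weyl_2form (fun=> null_gram R) th Gam u i j) <->
  asd_components Rlow i j.
Proof.
split=> [[a [b [c wE]]]|[e24 e13 e12]].
  have E p q : low_weyl Rlow i j p q =
     a * ((i1 == p)%:R * (i4 == q)%:R - (i1 == q)%:R * (i4 == p)%:R) +
     b * (((i3 == p)%:R * (i4 == q)%:R - (i3 == q)%:R * (i4 == p)%:R) +
          ((i1 == p)%:R * (i2 == q)%:R - (i1 == q)%:R * (i2 == p)%:R)) +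
     c * ((i3 == p)%:R * (i2 == q)%:R - (i3 == q)%:R * (i2 == p)%:R).
    rewrite -frame_comp_weyl_2form (funext wE) !frame_compD !frame_compZ !frame_compD.
    by rewrite !(frame_comp_wedge11 (uth Vu)).
  by split; rewrite !E /=; ring.
(* The components along M /\ K, N /\ K + M /\ P and N /\ P; the last changes sign because N /\ P = -
   theta^2 /\ theta^3. *)
exists (low_weyl Rlow i j i1 i4), (low_weyl Rlow i j i1 i2), (- low_weyl Rlow i j i2 i3).
move=> I; rewrite /weyl_2form !sum4 !weyl_tensorE !wedge11E.
have W := low_weyl_anti2 i j _ _ riemann_anti2.
have wkk k : low_weyl Rlow i j k k = 0.
  apply: (@mulfI _ 2); first by rewrite pnatr_eq0.
  by rewrite mulr0 mulr_natl mulr2n {1}W addNr.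
rewrite !mxE.
move: (th u) (low_weyl Rlow i j) W wkk e24 e13 e12 => T w W wkk e24 e13 e12.
rewrite !wkk (W i1 i2) (W i1 i3) (W i1 i4) (W i2 i3) (W i2 i4) (W i3 i4).
rewrite e24 e13 -e12.
by move: (I 0) (I 1) => x y; field.
Qed.

End LeviCivitaWeyl.

(** * The twistor forms *)

Section TwistorAlgebra.
Variables (R : realType) (n : nat) (G : 'I_4 -> 'I_4 -> 'rV[R[i]]_n).
Variables (T : 'I_4 -> 'rV[R[i]]_n) (dz : 'rV[R[i]]_n) (z : R[i]).
Variable I : 'I_5 -> 'I_n.
Hypothesis soG : so_relations G.

Let E := dz - G i3 i2 + z *: (G i1 i1 - G i4 i4) + z ^+ 2 *: G i2 i3.
Let F := T i1 + z *: T i4.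
Let B := T i3 + z *: T i2.
Let D := wedge5 E F B I.

(** Under D one may reduce modulo F, B and E: this and the next two facts solve them for M, N and
    dz. *)
Let D_T1 a : D a (T i1) = - z * D a (T i4).
Proof.
have := wedge5_F E F B I a; rewrite {2}/F wedge5Dr wedge5Zr -/D => /eqP.
by rewrite addr_eq0 => /eqP ->; rewrite mulNr.
Qed.

Let D_T3 a : D a (T i3) = - z * D a (T i2).
Proof.
have := wedge5_B E F B I a; rewrite {2}/B wedge5Dr wedge5Zr -/D => /eqP.
by rewrite addr_eq0 => /eqP ->; rewrite mulNr.
Qed.

Let D_dz a : D a dz = D a (G i3 i2) - z * (D a (G i1 i1) - D a (G i4 i4))
   - z ^+ 2 * D a (G i2 i3).
Proof.
have := wedge5_E E F B I a; rewrite {2}/E !wedge5Dr !wedge5Zr !wedge5Dr !wedge5Nr -/D.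
by move=> e; apply/eqP; rewrite -subr_eq0; apply/eqP; rewrite -[RHS]e; ring.
Qed.

Let D_anti a b : D b a = - D a b. Proof. exact: wedge5_anti. Qed.

(** The left side is D applied to dF = - Gamma^1_j /\ theta^j + dz /\ K - z Gamma^4_j /\ theta^j.
    After elimination of M, N and dz, the orthogonality relations make the coefficients cancel. *)
Lemma wedge5_dF : - (\sum_j D (G i1 j) (T j)) + D dz (T i4)
  + z * - (\sum_j D (G i4 j) (T j)) = 0.
Proof.
have [[x12 x21 x34 x43] [x22 x44] [x14 x41 x13 x31]] := soG.
rewrite !sum4 !D_T1 !D_T3 (D_anti (T i4) dz) D_dz.
rewrite ?x12 ?x21 ?x34 ?x43 ?x22 ?x44 ?x14 ?x41 ?x13 ?x31.
rewrite !(D_anti _ (T i4)) /D !wedge5Nl -/D.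
have D0 a : D 0 a = 0 by rewrite -(scale0r 0) /D wedge5Zl mul0r.
by rewrite !D0; ring.
Qed.

Lemma wedge5_dB : - (\sum_j D (G i3 j) (T j)) + D dz (T i2)
  + z * - (\sum_j D (G i2 j) (T j)) = 0.
Proof.
have [[x12 x21 x34 x43] [x22 x44] [x14 x41 x13 x31]] := soG.
rewrite !sum4 !D_T1 !D_T3 (D_anti (T i2) dz) D_dz.
rewrite ?x12 ?x21 ?x34 ?x43 ?x22 ?x44 ?x14 ?x41 ?x13 ?x31.
rewrite !(D_anti _ (T i2)) /D !wedge5Nl -/D.
have D0 a : D 0 a = 0 by rewrite -(scale0r 0) /D wedge5Zl mul0r.
by rewrite !D0; ring.
Qed.

(** The terms of dE free of curvature, with sign reversed where they come from Gamma /\ Gamma in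
    -dGamma. They vanish because one sl(2) factor of the orthogonal algebra acts on the fibre by
    vector fields quadratic in z, and this action respects brackets. *)
Lemma wedge5_dE : \sum_k D (G i3 k) (G k i2) + D dz (G i1 i1 - G i4 i4)
  - z * (\sum_k D (G i1 k) (G k i1) - \sum_k D (G i4 k) (G k i4))
  + 2 * z * D dz (G i2 i3) - z ^+ 2 * \sum_k D (G i2 k) (G k i3) = 0.
Proof.
have [[x12 x21 x34 x43] [x22 x44] [x14 x41 x13 x31]] := soG.
rewrite !sum4 !(D_anti _ dz) !D_dz.
rewrite ?x12 ?x21 ?x34 ?x43 ?x22 ?x44 ?x14 ?x41 ?x13 ?x31.
have D0 a : D 0 a = 0 by rewrite -(scale0r 0) /D wedge5Zl mul0r.
have D0r a : D a 0 = 0 by rewrite -(scale0r 0) /D wedge5Zr mul0r.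
have DNl a b : D (- a) b = - D a b by exact: wedge5Nl.
have DNr a b : D a (- b) = - D a b by exact: wedge5Nr.
have DDl a b c : D (a + b) c = D a c + D b c by exact: wedge5Dl.
have Dd a : D a a = 0 by exact: wedge5_diag.
have DDr a b c : D a (b + c) = D a b + D a c by exact: wedge5Dr.
rewrite !(DDl, DDr, DNl, DNr, D0, D0r, Dd).
(* Six connection forms are independent; their 15 products are put in a fixed order for [ring]. *)
rewrite ?(D_anti (G i1 i1) (G i2 i3)) ?(D_anti (G i1 i1) (G i2 i4)).
rewrite ?(D_anti (G i1 i1) (G i3 i2)) ?(D_anti (G i1 i1) (G i3 i3)).
rewrite ?(D_anti (G i1 i1) (G i4 i2)) ?(D_anti (G i2 i3) (G i2 i4)).
rewrite ?(D_anti (G i2 i3) (G i3 i2)) ?(D_anti (G i2 i3) (G i3 i3)).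
rewrite ?(D_anti (G i2 i3) (G i4 i2)) ?(D_anti (G i2 i4) (G i3 i2)).
rewrite ?(D_anti (G i2 i4) (G i3 i3)) ?(D_anti (G i2 i4) (G i4 i2)).
rewrite ?(D_anti (G i3 i2) (G i3 i3)) ?(D_anti (G i3 i2) (G i4 i2)).
rewrite ?(D_anti (G i3 i3) (G i4 i2)).
ring.
Qed.

(** Modulo F and B every product of two cotetrad forms is a multiple of P /\ K. The resulting
    coefficient is - S(zm - k, zn - p), the value of S on the null plane up to sign. *)
Lemma wedge5_frame (S : 'I_4 -> 'I_4 -> R[i]) :
  (forall k l, S l k = - S k l) ->
  \sum_k \sum_l 2^-1 * (S k l * D (T k) (T l)) =
  (S i2 i4 + z * (S i1 i2 - S i3 i4) - z ^+ 2 * S i1 i3) * D (T i2) (T i4).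
Proof.
move=> Santi; have Dd a : D a a = 0 by exact: wedge5_diag.
have n2 : (2 : R[i]) != 0 by rewrite pnatr_eq0.
have S0 k : S k k = 0.
  by apply: (mulfI n2); rewrite mulr0 mulr_natl mulr2n {1}Santi addNr.
rewrite !sum4 !S0 !mul0r (Santi i1 i2) (Santi i1 i3) (Santi i1 i4) (Santi i2 i3).
rewrite (Santi i2 i4) (Santi i3 i4) (D_anti (T i1) (T i2)) (D_anti (T i1) (T i3)).
rewrite (D_anti (T i1) (T i4)) (D_anti (T i2) (T i3)) (D_anti (T i2) (T i4)).
rewrite (D_anti (T i4) (T i3)).
have e12 : D (T i1) (T i2) = z * D (T i2) (T i4).
  by rewrite D_anti D_T1; ring.
have e13 : D (T i1) (T i3) = - z ^+ 2 * D (T i2) (T i4).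
  by rewrite D_T3 e12; ring.
have e14 : D (T i1) (T i4) = 0 by rewrite D_anti D_T1 Dd mulr0 oppr0.
have e23 : D (T i2) (T i3) = 0 by rewrite D_T3 Dd mulr0.
have e43 : D (T i4) (T i3) = z * D (T i2) (T i4).
  by rewrite D_T3 D_anti; ring.
by rewrite e12 e13 e14 e23 e43; field.
Qed.

End TwistorAlgebra.

(** * Exterior derivatives of sums and products *)

Section FormCalculus.
Variables (R : realType) (n : nat).
Implicit Types (w : 'rV[R]_n -> 'rV[R[i]]_n) (f : 'rV[R]_n -> R[i]) (y : 'rV[R]_n).

Definition form_derivable w y := forall c a, cderivable (fun v => w v 0 c) y a.

Lemma form_derivableD w w' y : form_derivable w y -> form_derivable w' y ->
  form_derivable (fun v => w v + w' v) y.
Proof.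
move=> dw dw' c a; rewrite (_ : (fun v => _) = fun v => w v 0 c + w' v 0 c).
  exact: cderivableD.
by apply/funext => v; rewrite mxE.
Qed.

Lemma form_derivableZ f w y : (forall a, cderivable f y a) -> form_derivable w y ->
  form_derivable (fun v => f v *: w v) y.
Proof.
move=> df dw c a; rewrite (_ : (fun v => _) = fun v => f v * w v 0 c).
  exact: cderivableM.
by apply/funext => v; rewrite mxE.
Qed.

Let eq_fun_cpartial f g a y : f =1 g -> cpartial a f y = cpartial a g y.
Proof. by move=> /funext ->. Qed.

Lemma d1D w w' y I : form_derivable w y -> form_derivable w' y ->
  d1 (fun v => w v + w' v) y I = d1 w y I + d1 w' y I.
Proof.
move=> dw dw'; rewrite /d1.
have E c a : cpartial a (fun v => (w v + w' v) 0 c) y =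
    cpartial a (fun v => w v 0 c) y + cpartial a (fun v => w' v 0 c) y.
  rewrite -(cpartialD (dw c a) (dw' c a)); apply: eq_fun_cpartial => v.
  by rewrite mxE.
by rewrite !E opprD addrACA.
Qed.

Lemma d1Z f w y I : (forall a, cderivable f y a) -> form_derivable w y ->
  d1 (fun v => f v *: w v) y I = wedge11 (d0 f y) (w y) I + f y * d1 w y I.
Proof.
move=> df dw; rewrite /d1 wedge11E !mxE.
have E c a : cpartial a (fun v => (f v *: w v) 0 c) y =
    cpartial a f y * w y 0 c + f y * cpartial a (fun v => w v 0 c) y.
  rewrite -(cpartialM (df a) (dw c a)); apply: eq_fun_cpartial => v.
  by rewrite mxE.
by rewrite !E mulrBr opprD addrACA.
Qed.

Lemma form_derivableN w y : form_derivable w y ->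
  form_derivable (fun v => - w v) y.
Proof.
move=> dw c a; rewrite (_ : (fun v => _) = fun v => - w v 0 c).
  exact: cderivableN.
by apply/funext => v; rewrite mxE.
Qed.

Lemma d1N w y I : form_derivable w y -> d1 (fun v => - w v) y I = - d1 w y I.
Proof.
move=> dw; rewrite /d1.
have E c a : cpartial a (fun v => (- w v) 0 c) y = - cpartial a (fun v => w v 0 c) y.
  by rewrite -(cpartialN (dw c a)); apply: eq_fun_cpartial => v; rewrite mxE.
by rewrite !E opprB opprK addrC.
Qed.

End FormCalculus.

(** * Pullback along the bundle projection, and the form dz *)

Section Pullback.
Variable R : realType.
Implicit Types (f : 'rV[R]_4 -> R[i]) (y : 'rV[R]_(4 + 2)).

Let lsubmx_line (h : R) (v y : 'rV[R]_(4 + 2)) :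
  lsubmx (h *: v + y) = h *: lsubmx v + lsubmx y.
Proof. by apply/rowP => c; rewrite !mxE. Qed.

(** The projection is linear, so lines project to lines and the two difference quotients are the
    same function. *)
Let derive_lsubmx (g : 'rV[R]_4 -> R) y (v : 'rV[R]_(4 + 2)) :
  'D_v (fun y => g (lsubmx y)) y = 'D_(lsubmx v) g (lsubmx y).
Proof.
rewrite /derive; set g1 := fun h => h^-1 *: _; set g2 := fun h => h^-1 *: _.
suff -> : g1 = g2 by [].
by apply/funext => h; rewrite /g1 /g2 /= lsubmx_line.
Qed.

Let derivable_lsubmx (g : 'rV[R]_4 -> R) y (v : 'rV[R]_(4 + 2)) :
  derivable g (lsubmx y) (lsubmx v) -> derivable (fun y => g (lsubmx y)) y v.
Proof.
rewrite /derivable; set g1 := fun h => h^-1 *: _; set g2 := fun h => h^-1 *: _.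
suff -> : g1 = g2 by [].
by apply/funext => h; rewrite /g1 /g2 /= lsubmx_line.
Qed.

Let lsubmx_delta (a : 'I_(4 + 2)) :
  lsubmx (delta_mx 0 a : 'rV[R]_(4 + 2)) =
  if fintype.split a is inl b then delta_mx 0 b else 0.
Proof.
apply/rowP => c; rewrite mxE; case: split_ordP => b ->; rewrite !mxE eqxx /=.
  by rewrite (inj_eq (@lshift_inj _ _)).
by rewrite eq_lrshift.
Qed.

Lemma cpartial_pullback f y (a : 'I_(4 + 2)) :
  cpartial a (fun y => f (lsubmx y)) y =
  if fintype.split a is inl b then cpartial b f (lsubmx y) else 0.
Proof.
rewrite /cpartial (derive_lsubmx (fun u => complex.Re (f u))).
rewrite (derive_lsubmx (fun u => complex.Im (f u))) lsubmx_delta.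
by case: fintype.split => b //; rewrite !derive0.
Qed.

Lemma cderivable_pullback f y :
  (forall b, cderivable f (lsubmx y) b) ->
  forall a, cderivable (fun y => f (lsubmx y)) y a.
Proof.
move=> df a; rewrite /cderivable.
suff H (g : 'rV[R]_4 -> R) : (forall b, derivable g (lsubmx y) (delta_mx 0 b)) ->
    derivable (fun y => g (lsubmx y)) y (delta_mx 0 a).
  split; first by apply: (H (fun u => complex.Re (f u))) => b; have [] := df b.
  by apply: (H (fun u => complex.Im (f u))) => b; have [] := df b.
move=> dg; apply: derivable_lsubmx; rewrite lsubmx_delta; case: fintype.split => b //.
exact: derivable0.
Qed.

Definition extend (b : 'rV[R[i]]_4) : 'rV[R[i]]_(4 + 2) := row_mx b 0.

Definition pull2 (w : kform R 4 2) : kform R (4 + 2) 2 := fun I =>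
  match fintype.split (I 0), fintype.split (I 1) with
  | inl a, inl b => w (pairi a b)
  | _, _ => 0
  end.

Lemma pull2_wedge11 b c I : pull2 (wedge11 b c) I = wedge11 (extend b) (extend c) I.
Proof.
rewrite wedge11E /pull2 /extend !mxE.
case: (fintype.split (I 0)) => ?; case: (fintype.split (I 1)) => ?;
by rewrite ?wedge11E ?mxE ?(mul0r, mulr0, subr0).
Qed.

Lemma pull2D w w' I : pull2 (fun J => w J + w' J) I = pull2 w I + pull2 w' I.
Proof.
rewrite /pull2; case: (fintype.split (I 0)) => ?;
by case: (fintype.split (I 1)) => ? //; rewrite addr0.
Qed.

Lemma pull2Z x w I : pull2 (fun J => x * w J) I = x * pull2 w I.
Proof.
rewrite /pull2; case: (fintype.split (I 0)) => ?;
by case: (fintype.split (I 1)) => ? //; rewrite mulr0.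
Qed.

Lemma pull2_sum (J : finType) (w : J -> kform R 4 2) I :
  pull2 (fun K => \sum_j w j K) I = \sum_j pull2 (w j) I.
Proof.
rewrite /pull2; case: (fintype.split (I 0)) => ?;
by case: (fintype.split (I 1)) => ? //; rewrite big1.
Qed.

Lemma eq_pull2 w w' I : (forall J, w J = w' J) -> pull2 w I = pull2 w' I.
Proof.
move=> e; rewrite /pull2; case: (fintype.split (I 0)) => ?;
by case: (fintype.split (I 1)) => ?.
Qed.

Section AtPoint.
Variables (w : 'rV[R]_4 -> 'rV[R[i]]_4) (y : 'rV[R]_(4 + 2)).
Hypothesis dw : form_derivable w (lsubmx y).

Let pullback_comp c : (fun v => pullback w v 0 c) =
  if fintype.split c is inl d then fun v => (fun u => w u 0 d) (lsubmx v) else fun=> 0.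
Proof.
by apply/funext => v; rewrite /pullback mxE; case: fintype.split => d //; rewrite mxE.
Qed.

Lemma form_derivable_pullback : form_derivable (pullback w) y.
Proof.
move=> c a; rewrite pullback_comp; case: fintype.split => d; last exact: cderivable_cst.
by apply: (cderivable_pullback (f := fun u => w u 0 d)) => b.
Qed.

Lemma d1_pullback I : d1 (pullback w) y I = pull2 (d1 w (lsubmx y)) I.
Proof.
rewrite /d1 !pullback_comp /pull2.
have E c a : cpartial a (if fintype.split c is inl d
    then fun v => (fun u => w u 0 d) (lsubmx v) else fun=> 0) y =
    if fintype.split c is inl d then
      if fintype.split a is inl b then cpartial b (fun u => w u 0 d) (lsubmx y) else 0
    else 0.
  case: fintype.split => d; last exact: cpartial_cst.
  exact: (cpartial_pullback (fun u => w u 0 d)).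
by rewrite !E; case: fintype.split => b; case: fintype.split => c //; rewrite subr0.
Qed.

End AtPoint.

Let fibreE y : @fibre_coord R y = y 0 (rshift 4 0) +i* y 0 (rshift 4 1).
Proof. by rewrite /fibre_coord !mxE. Qed.

Let is_derive_entry (c : 'I_(4 + 2)) y (v : 'rV[R]_(4 + 2)) :
  is_derive y v (fun u : 'rV[R]_(4 + 2) => u 0 c) (v 0 c).
Proof.
have E : (fun h : R => h^-1 *: (((fun u : 'rV[R]_(4 + 2) => u 0 c) \o shift y)
    (h *: v) - y 0 c)) @ 0^' --> v 0 c.
  apply: cvg_near_cst; near=> h; rewrite /= !mxE addrK.
  rewrite [_ *: _]mulrA mulVf ?mul1r //; near: h; exact: nbhs_dnbhs_neq.
apply: DeriveDef; first by apply/cvg_ex; exists (v 0 c).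
exact: cvg_lim E.
Unshelve. all: by end_near. Qed.

Lemma cderivable_fibre_coord y a : cderivable (@fibre_coord R) y a.
Proof.
split.
  rewrite (_ : (fun v => _) = fun v : 'rV[R]_(4 + 2) => v 0 (rshift 4 0)).
    by have [] := is_derive_entry (rshift 4 0) y (delta_mx 0 a).
  by apply/funext => v; rewrite fibreE.
rewrite (_ : (fun v => _) = fun v : 'rV[R]_(4 + 2) => v 0 (rshift 4 1)).
  by have [] := is_derive_entry (rshift 4 1) y (delta_mx 0 a).
by apply/funext => v; rewrite fibreE.
Qed.

Lemma dfibreE y : dfibre y = \row_c
  (((rshift 4 0 == c)%:R : R) +i* ((rshift 4 1 == c)%:R : R)).
Proof.
apply/rowP => a; rewrite !mxE /cpartial; congr (_ +i* _).
  rewrite (_ : (fun v => _) = fun v : 'rV[R]_(4 + 2) => v 0 (rshift 4 0)).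
    by have [_ ->] := is_derive_entry (rshift 4 0) y (delta_mx 0 a); rewrite !mxE eqxx.
  by apply/funext => v; rewrite fibreE.
rewrite (_ : (fun v => _) = fun v : 'rV[R]_(4 + 2) => v 0 (rshift 4 1)).
  by have [_ ->] := is_derive_entry (rshift 4 1) y (delta_mx 0 a); rewrite !mxE eqxx.
by apply/funext => v; rewrite fibreE.
Qed.

Lemma form_derivable_dfibre y : form_derivable (@dfibre R) y.
Proof.
move=> c a; rewrite (_ : (fun v => _) = fun=> dfibre y 0 c).
  exact: cderivable_cst.
by apply/funext => v; rewrite !dfibreE.
Qed.

Lemma d1_dfibre y I : d1 (@dfibre R) y I = 0.
Proof.
have E c a : cpartial a (fun v => @dfibre R v 0 c) y = 0.
  rewrite (_ : (fun v => _) = fun=> dfibre y 0 c); first exact: cpartial_cst.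
  by apply/funext => v; rewrite !dfibreE.
by rewrite /d1 !E subr0.
Qed.

End Pullback.

(** * Differentials of the twistor forms *)

Section TwistorForms.
Variables (R : realType) (V : set 'rV[R]_4) (th : 'rV[R]_4 -> 'M[R[i]]_4).
Variable Gam : 'I_4 -> 'I_4 -> 'rV[R]_4 -> 'rV[R[i]]_4.
Hypotheses (openV : open V) (sth : csmooth_mx V th).
Hypothesis lc : levi_civita V (fun=> null_gram R) th Gam.
Variable y : 'rV[R]_(4 + 2).
Hypothesis Vy : V (lsubmx y).

Let u := lsubmx y.
Let z := fibre_coord y.
Let dz := dfibre y.
Let G i j := extend (Gam i j u).
Let T i := extend (row i (th u)).
Let Om i j := pull2 (curvature_form Gam i j u).

Let dGam i j : form_derivable (Gam i j) u.
Proof.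
by move=> c a; apply: csmooth_cderivable Vy _; have [sG _ _] := lc; exact: sG.
Qed.

Let dth i : form_derivable (fun v => row i (th v)) u.
Proof.
move=> c a; apply: csmooth_cderivable Vy _.
rewrite (_ : (fun v => _) = fun v => th v i c); first exact: sth.
by apply/funext => v; rewrite mxE.
Qed.

Lemma d1_pullback_coframe i I :
  d1 (pullback (fun v => row i (th v))) y I = - \sum_j wedge11 (G i j) (T j) I.
Proof.
rewrite d1_pullback; have [_ _ tor] := lc.
rewrite (@eq_pull2 _ _ (fun J => -1 * \sum_j wedge11 (Gam i j u) (row j (th u)) J)).
  rewrite pull2Z mulN1r pull2_sum; congr (- _); apply: eq_bigr => j _.
  by rewrite pull2_wedge11.
by move=> J; rewrite tor // mulN1r.
Qed.

Lemma d1_pullback_connection i j I :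
  d1 (pullback (Gam i j)) y I = Om i j I - \sum_k wedge11 (G i k) (G k j) I.
Proof.
rewrite d1_pullback /Om.
rewrite (@eq_pull2 _ _ (fun J => curvature_form Gam i j u J +
  -1 * \sum_k wedge11 (Gam i k u) (Gam k j u) J)).
  rewrite pull2D pull2Z mulN1r pull2_sum; congr (_ - _); apply: eq_bigr => k _.
  by rewrite pull2_wedge11.
by move=> J; rewrite /curvature_form mulN1r addrK.
Qed.

Let dfib a : cderivable (@fibre_coord R) y a.
Proof. exact: cderivable_fibre_coord. Qed.

(** Serves F with (i, k) = (1, 4) and B with (i, k) = (3, 2). *)
Lemma d1_twistor_affine i k I :
  d1 (fun v => pullback (fun u => row i (th u)) v
               + fibre_coord v *: pullback (fun u => row k (th u)) v) y I =
  - (\sum_j wedge11 (G i j) (T j) I) + wedge11 dz (T k) I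
  + z * - (\sum_j wedge11 (G k j) (T j) I).
Proof.
have dk := form_derivable_pullback (@dth k).
rewrite (d1D _ (form_derivable_pullback (@dth i)) (form_derivableZ dfib dk)).
by rewrite (d1Z _ dfib dk) !d1_pullback_coframe addrA.
Qed.

Lemma d0_fibre_coord_sqr : d0 (fun v => @fibre_coord R v ^+ 2) y = (2 * z) *: dz.
Proof.
apply/rowP => a; rewrite !mxE.
rewrite (_ : (fun v => _) = fun v => fibre_coord v * fibre_coord v) //.
by rewrite (cpartialM (dfib a) (dfib a)) /z; ring.
Qed.

Lemma d1_twistor_E I : d1 (twistor_E Gam) y I =
  - (Om i3 i2 I - \sum_k wedge11 (G i3 k) (G k i2) I)
  + (wedge11 dz (G i1 i1 - G i4 i4) I
     + z * (Om i1 i1 I - \sum_k wedge11 (G i1 k) (G k i1) I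
           - (Om i4 i4 I - \sum_k wedge11 (G i4 k) (G k i4) I)))
  + (2 * z * wedge11 dz (G i2 i3) I
     + z ^+ 2 * (Om i2 i3 I - \sum_k wedge11 (G i2 k) (G k i3) I)).
Proof.
have dP i j := form_derivable_pullback (@dGam i j).
have dN i j := form_derivableN (dP i j).
have dsq a : cderivable (fun v => @fibre_coord R v ^+ 2) y a.
  rewrite (_ : (fun v => _) = fun v => fibre_coord v * fibre_coord v) //.
  exact: cderivableM.
have d11 := form_derivableD (dP i1 i1) (dN i4 i4).
have d0 := form_derivableD (@form_derivable_dfibre R y) (dN i3 i2).
have d01 := form_derivableD d0 (form_derivableZ dfib d11).
have d2 := form_derivableZ dsq (dP i2 i3).
rewrite /twistor_E (d1D _ d01 d2) (d1D _ d0 (form_derivableZ dfib d11)).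
rewrite (d1D _ (@form_derivable_dfibre R y) (dN i3 i2)) (d1Z _ dsq (dP i2 i3)).
rewrite (d1Z _ dfib d11) (d1D _ (dP i1 i1) (dN i4 i4)) !(d1N _ (dP _ _)).
rewrite !d1_pullback_connection d1_dfibre add0r d0_fibre_coord_sqr.
by congr (_ + _ + (_ + _)); rewrite !wedge11E !mxE -/z; ring.
Qed.

Variable I : 'I_5 -> 'I_(4 + 2).

Let E := twistor_E Gam y.
Let F := twistor_F th y.
Let B := twistor_B th y.

Let soG : so_relations G.
Proof.
have [[x12 x21 x34 x43] [x22 x44] [x14 x41 x13 x31]] := levi_civita_so lc Vy.
have e0 : extend (0 : 'rV[R[i]]_4) = 0 by rewrite /extend row_mx0.
have eN (b : 'rV[R[i]]_4) : extend (- b) = - extend b.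
  by rewrite /extend opp_row_mx oppr0.
by split; split; rewrite /G ?x12 ?x21 ?x34 ?x43 ?x22 ?x44 ?x14 ?x41 ?x13 ?x31 ?e0 ?eN.
Qed.

Lemma wedge3_d1_twistor_F : wedge3 E F B I (d1 (twistor_F th) y) = 0.
Proof.
have -> : d1 (twistor_F th) y = fun J =>
    - (\sum_j wedge11 (G i1 j) (T j) J) + wedge11 dz (T i4) J
    + z * - (\sum_j wedge11 (G i4 j) (T j) J).
  by apply/funext => J; rewrite -d1_twistor_affine.
rewrite !(wedge3D, wedge3Z, wedge3N, wedge3_sum11).
exact: (wedge5_dF T dz z I soG).
Qed.

Lemma wedge3_d1_twistor_B : wedge3 E F B I (d1 (twistor_B th) y) = 0.
Proof.
have -> : d1 (twistor_B th) y = fun J =>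
    - (\sum_j wedge11 (G i3 j) (T j) J) + wedge11 dz (T i2) J
    + z * - (\sum_j wedge11 (G i2 j) (T j) J).
  by apply/funext => J; rewrite -d1_twistor_affine.
rewrite !(wedge3D, wedge3Z, wedge3N, wedge3_sum11).
exact: (wedge5_dB T dz z I soG).
Qed.

(** Only the terms linear in the curvature survive: those in Gamma /\ Gamma and dz /\ Gamma form the
    sum killed by [wedge5_dE]. *)
Lemma wedge3_d1_twistor_E_curvature :
  wedge3 E F B I (d1 (twistor_E Gam) y) =
  - wedge3 E F B I (Om i3 i2)
  + z * (wedge3 E F B I (Om i1 i1) - wedge3 E F B I (Om i4 i4))
  + z ^+ 2 * wedge3 E F B I (Om i2 i3).
Proof.
rewrite (funext d1_twistor_E) !(wedge3D, wedge3Z, wedge3N, wedge3_sum11).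
have cancel (o32 o11 o44 o23 s32 s11 s44 s23 a b x : R[i]) :
    s32 + a - x * (s11 - s44) + 2 * x * b - x ^+ 2 * s23 = 0 ->
    - (o32 - s32) + (a + x * (o11 - s11 - (o44 - s44)))
    + (2 * x * b + x ^+ 2 * (o23 - s23)) = - o32 + x * (o11 - o44) + x ^+ 2 * o23.
  by move=> e; rewrite -[RHS]addr0 -[X in _ = _ + X]e; ring.
exact: cancel (wedge5_dE T dz z I soG).
Qed.

End TwistorForms.

(** * The quartic in the fibre coordinate *)

Section TwistorQuartic.
Variables (C : numFieldType) (r L : 'I_4 -> 'I_4 -> 'I_4 -> 'I_4 -> C) (z : C).

Definition twistor_curvature k l : C :=
  - r i3 i2 k l + z * (r i1 i1 k l - r i4 i4 k l) + z ^+ 2 * r i2 i3 k l.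

Lemma twistor_curvature_sum (D : 'I_4 -> 'I_4 -> C) :
  - (\sum_k \sum_l 2^-1 * (r i3 i2 k l * D k l))
  + z * (\sum_k \sum_l 2^-1 * (r i1 i1 k l * D k l)
         - \sum_k \sum_l 2^-1 * (r i4 i4 k l * D k l))
  + z ^+ 2 * (\sum_k \sum_l 2^-1 * (r i2 i3 k l * D k l))
  = \sum_k \sum_l 2^-1 * (twistor_curvature k l * D k l).
Proof.
rewrite -sumrB !mulr_sumr -sumrN -!big_split; apply: eq_bigr => k _ /=.
rewrite -sumrB !mulr_sumr -sumrN -!big_split; apply: eq_bigr => l _ /=.
by rewrite /twistor_curvature; ring.
Qed.

Lemma twistor_curvature_anti k l : (forall i j, r i j l k = - r i j k l) ->
  twistor_curvature l k = - twistor_curvature k l.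
Proof. by move=> ra; rewrite /twistor_curvature !ra; ring. Qed.

(** Once lowered, the first index pair enters through L_24 + z (L_12 - L_34) - z^2 L_13 with factor
    -2, the same expression that [wedge5_frame] produces in the second pair. The z^3 term pairs z
    with -z^2, hence the sign of [psi3]. *)
Lemma twistor_curvature_quartic :
  (forall j k l, [/\ r i1 j k l = 2 * L i2 j k l, r i2 j k l = 2 * L i1 j k l,
    r i3 j k l = - 2 * L i4 j k l & r i4 j k l = - 2 * L i3 j k l]) ->
  (forall i j k l, L j i k l = - L i j k l) ->
  twistor_curvature i2 i4 + z * (twistor_curvature i1 i2 - twistor_curvature i3 i4)
  - z ^+ 2 * twistor_curvature i1 i3 =
  - 2 * (psi0 L + z * psi1 L + z ^+ 2 * psi2 L + z ^+ 3 * - psi3 L + z ^+ 4 * psi4 L).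
Proof.
move=> lowE La.
have SE k l : twistor_curvature k l =
    - 2 * (L i2 i4 k l + z * (L i1 i2 k l - L i3 i4 k l) - z ^+ 2 * L i1 i3 k l).
  rewrite /twistor_curvature; have [_ _ -> _] := lowE i2 k l.
  have [-> _ _ _] := lowE i1 k l; have [_ _ _ ->] := lowE i4 k l.
  have [_ -> _ _] := lowE i3 k l.
  by rewrite (La i2 i4) (La i1 i2); ring.
by rewrite !SE /psi0 /psi1 /psi2 /psi3 /psi4; ring.
Qed.

End TwistorQuartic.

Section TwistorCurvature.
Variables (R : realType) (V : set 'rV[R]_4) (th : 'rV[R]_4 -> 'M[R[i]]_4).
Variable Gam : 'I_4 -> 'I_4 -> 'rV[R]_4 -> 'rV[R[i]]_4.
Hypothesis openV : open V.
Hypothesis uth : forall u, V u -> th u \in unitmx.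
Hypothesis lc : levi_civita V (fun=> null_gram R) th Gam.

Section AtPoint.
Variable y : 'rV[R]_(4 + 2).
Hypothesis Vy : V (lsubmx y).

Let u := lsubmx y.
Let z := fibre_coord y.
Let T i := extend (row i (th u)).
Let E := twistor_E Gam y.
Let F := twistor_F th y.
Let B := twistor_B th y.
Let r := riemann_up th Gam u.
Let L := riemann (fun=> null_gram R) th Gam u.

Section Columns.
Variable I : 'I_5 -> 'I_(4 + 2).

Let D := wedge5 E F B I.

Lemma wedge3_pull2_curvature i j :
  wedge3 E F B I (pull2 (curvature_form Gam i j u)) =
  \sum_k \sum_l 2^-1 * (r i j k l * D (T k) (T l)).
Proof.
have -> : pull2 (curvature_form Gam i j u) = fun J =>
    \sum_k \sum_l 2^-1 * (r i j k l * wedge11 (T k) (T l) J).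
  apply/funext => J; rewrite (@eq_pull2 _ _ (fun K => \sum_k \sum_l
      2^-1 * (r i j k l * wedge11 (row k (th u)) (row l (th u)) K))); last first.
    by move=> K; rewrite (frame_decomp (uth Vy) _ (curvature_form_anti Gam i j u)).
  rewrite pull2_sum; apply: eq_bigr => k _; rewrite pull2_sum; apply: eq_bigr => l _.
  by rewrite !pull2Z pull2_wedge11.
rewrite wedge3_sum; apply: eq_bigr => k _; rewrite wedge3_sum; apply: eq_bigr => l _.
by rewrite !wedge3Z.
Qed.

Lemma wedge3_d1_twistor_E : wedge3 E F B I (d1 (twistor_E Gam) y) =
  - 2 * (psi0 L + z * psi1 L + z ^+ 2 * psi2 L + z ^+ 3 * - psi3 L + z ^+ 4 * psi4 L)
  * D (T i2) (T i4).
Proof.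
rewrite (wedge3_d1_twistor_E_curvature lc Vy) !wedge3_pull2_curvature.
rewrite (twistor_curvature_sum r z (fun k l => D (T k) (T l))).
have Santi k l : twistor_curvature r z l k = - twistor_curvature r z k l.
  by apply: twistor_curvature_anti => i j; exact: riemann_up_anti2.
apply: etrans (wedge5_frame (fun i j => extend (Gam i j u)) T (dfibre y) z I Santi) _.
congr (_ * _).
apply: twistor_curvature_quartic; first exact: riemann_up_lower.
exact: (riemann_anti1 openV lc Vy).
Qed.

End Columns.
End AtPoint.
End TwistorCurvature.

(* The coordinates other than Im z. *)
Definition twistor_columns (c : 'I_(4 + 1)) : 'I_(4 + 2) :=
  match fintype.split c with
  | inl a => lshift 2 a
  | inr _ => rshift 4 0
  end.

Section NonDegenerate.
Variables (R : realType) (th : 'rV[R]_4 -> 'M[R[i]]_4).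
Variable Gam : 'I_4 -> 'I_4 -> 'rV[R]_4 -> 'rV[R[i]]_4.
Variable y : 'rV[R]_(4 + 2).
Hypothesis uth : th (lsubmx y) \in unitmx.

Let T i := extend (row i (th (lsubmx y))).

(** E is the only row with a dz part, and (P, K, F, B) is an invertible combination of the cotetrad
    for every z. *)
Lemma wedge5_twistor_neq0 :
  wedge5 (twistor_E Gam y) (twistor_F th y) (twistor_B th y) twistor_columns
    (T i2) (T i4) != 0.
Proof.
pose z := fibre_coord y.
have ext_r (b : 'rV[R[i]]_4) : extend b 0 (rshift 4 0) = 0.
  by rewrite /extend row_mxEr mxE.
have pull_r w : @pullback R w y 0 (rshift 4 0) = 0.
  by rewrite /pullback row_mxEr mxE.
have pull_l w (c : 'I_4) : @pullback R w y 0 (lshift 2 c) = w (lsubmx y) 0 c.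
  by rewrite /pullback row_mxEl.
have cmax : twistor_columns (@ord_max 4) = rshift 4 0.
  rewrite /twistor_columns; case: split_ordP => // a /(congr1 val) /= e.
  by have := ltn_ord a; rewrite -e.
have clift (c : 'I_4) : twistor_columns (lift (@ord_max 4) c) = lshift 2 c.
  have lm : val (lift (@ord_max 4) c) = c := lift_max c.
  rewrite /twistor_columns; case: split_ordP => a /(congr1 val) /(etrans (esym lm)) /= e.
    by congr lshift; apply: val_inj.
  by have := ltn_ord c; rewrite e ltnNge leq_addr.
have entryD (b c : 'rV[R[i]]_(4 + 2)) j : (b + c) 0 j = b 0 j + c 0 j by rewrite mxE.
have entryN (b : 'rV[R[i]]_(4 + 2)) j : (- b) 0 j = - b 0 j by rewrite mxE.
have entryZ x (b : 'rV[R[i]]_(4 + 2)) j : (x *: b) 0 j = x * b 0 j by rewrite mxE.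
have FB_r : twistor_F th y 0 (rshift 4 0) = 0 /\ twistor_B th y 0 (rshift 4 0) = 0.
  by rewrite /twistor_F /twistor_B !(entryD, entryZ, pull_r) !mulr0 !addr0.
have FB_l c : twistor_F th y 0 (lshift 2 c) = th (lsubmx y) i1 c + z * th (lsubmx y) i4 c
  /\ twistor_B th y 0 (lshift 2 c) = th (lsubmx y) i3 c + z * th (lsubmx y) i2 c.
  rewrite /twistor_F /twistor_B !(entryD, entryZ, pull_l).
  by split; congr (_ + _ * _); rewrite mxE.
have T_l k c : T k 0 (lshift 2 c) = th (lsubmx y) k c.
  by rewrite /T /extend row_mxEl mxE.
have E1 : twistor_E Gam y 0 (rshift 4 0) = 1.
  have dz1 : dfibre y 0 (rshift 4 0) = 1.
    by rewrite dfibreE mxE eqxx; apply/eqP; rewrite eq_complex /= !eqxx.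
  rewrite /twistor_E !(entryD, entryN, entryZ, pull_r) dz1.
  by rewrite !(subr0, mulr0, addr0).
rewrite wedge5_det (expand_det_col _ (@ord_max 4)).
(* The last column belongs to Re z, and its only nonzero entry, 1, is in the row of E. *)
rewrite (bigD1 (lift ord0 (lift ord0 ord0))) //=.
rewrite big1 => [|k kn2]; last first.
  apply/eqP; rewrite mulf_eq0; apply/orP; left; rewrite mxE cmax.
  case: k kn2 => -[|[|[|[|[|//]]]]] lt5 //= _; rewrite ?ext_r //.
    exact/eqP/FB_r.1.
  exact/eqP/FB_r.2.
rewrite addr0 mxE cmax /= E1 mul1r /cofactor mulf_eq0 negb_or signr_eq0 /=.
(* C writes P, K, M + zK and N + zP in terms of M, P, N, K; C' solves these relations back. *)
pose C : 'M[R[i]]_4 := \matrix_(a, b)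
  (nth [::] [:: [:: 0; 1; 0; 0]; [:: 0; 0; 0; 1]; [:: 1; 0; 0; z];
             [:: 0; z; 1; 0]] a)`_b.
pose C' : 'M[R[i]]_4 := \matrix_(a, b)
  (nth [::] [:: [:: 0; - z; 1; 0]; [:: 1; 0; 0; 0]; [:: - z; 0; 0; 1];
             [:: 0; 1; 0; 0]] a)`_b.
have CC : C' *m C = 1%:M.
  apply/matrixP => a b; rewrite mxE sum4 !mxE.
  by case: (ord4P a) => ->; case: (ord4P b) => ->; rewrite /=; ring.
have [_ uC] := mulmx1_unit CC.
have det_neq0 (A : 'M[R[i]]_4) : A = C *m th (lsubmx y) -> \det A != 0.
  by move=> ->; rewrite det_mulmx mulf_neq0 // -unitfE -unitmxE.
apply: det_neq0.
have CE a b : (C *m th (lsubmx y)) a b = \sum_k C a k * th (lsubmx y) k b by rewrite mxE.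
apply/matrixP => a b; rewrite CE sum4 !mxE clift; have [Fb Bb] := FB_l b.
by case: (ord4P a) => -> /=; rewrite ?T_l ?Fb ?Bb; ring.
Qed.

End NonDegenerate.

(** * Closed ideals *)

Section ClosedIdeal.
Variables (R : realType) (n : nat).
Implicit Types (E F B : 'rV[R]_n -> 'rV[R[i]]_n) (f g : 'rV[R]_n -> R[i]).

Lemma closed_ideal3P (Y : set 'rV[R]_n) E F B : closed_ideal3 Y E F B <->
  (forall y, Y y -> forall I, [/\ wedge3 (E y) (F y) (B y) I (d1 F y) = 0,
    wedge3 (E y) (F y) (B y) I (d1 B y) = 0
    & wedge3 (E y) (F y) (B y) I (d1 E y) = 0]).
Proof.
split=> H y Yy => [I|].
  have [eF eB eE] := H y Yy.
  exact: And3 (congr1 (@^~ I) eF) (congr1 (@^~ I) eB) (congr1 (@^~ I) eE).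
split; apply/funext => I; have [eF eB eE] := H y Yy I.
- exact: eF.
- exact: eB.
- exact: eE.
Qed.

Lemma d1_anti (w : 'rV[R]_n -> 'rV[R[i]]_n) y a b :
  d1 w y (pairi b a) = - d1 w y (pairi a b).
Proof. by rewrite /d1 opprB. Qed.

Lemma wedge3_alt_eq0 (E F B : 'rV[R[i]]_n) I (w : kform R n 2) :
  (forall a b, w (pairi b a) = - w (pairi a b)) ->
  (forall a b, wedge5 E F B I a b = 0) -> wedge3 E F B I w = 0.
Proof.
(* An alternating 2-form decomposes in the coordinate coframe, given by the identity matrix. *)
move=> walt H; have u1 : (1%:M : 'M[R[i]]_n) \in unitmx by rewrite unitmx1.
rewrite (funext (fun J => frame_decomp u1 J walt)) wedge3_sum big1 // => k _.
rewrite wedge3_sum big1 // => l _; rewrite !wedge3Z -/(wedge5 _ _ _ _ _ _).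
by rewrite H !mulr0.
Qed.

Lemma wedge3_E_shift (E F B : 'rV[R[i]]_n) I (w : kform R n 2) x x' :
  (forall a b, w (pairi b a) = - w (pairi a b)) ->
  wedge3 (E + (x *: F + x' *: B)) F B I w = wedge3 E F B I w.
Proof.
move=> walt.
have FF : wedge3 F F B I w = 0.
  apply: wedge3_alt_eq0 => // a b.
  by apply: (@wedge5_dup _ _ _ _ _ _ _ _ (inord 2) (inord 3));
    rewrite -?val_eqE /= !inordK.
have BB : wedge3 B F B I w = 0.
  apply: wedge3_alt_eq0 => // a b.
  by apply: (@wedge5_dup _ _ _ _ _ _ _ _ (inord 2) (inord 4));
    rewrite -?val_eqE /= !inordK.
have -> : wedge3 (E + (x *: F + x' *: B)) F B I w =
    wedge3 E F B I w + (x * wedge3 F F B I w + x' * wedge3 B F B I w).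
  have slot : wedge w (E + (x *: F + x' *: B)) =
      fun J => wedge w E J + (x * wedge w F J + x' * wedge w B J).
    by apply/funext => J; rewrite wedgeDr wedgeDr !wedgeZr.
  by rewrite {1}/wedge3 slot !wedgeDl !wedgeZl.
by rewrite FF BB !mulr0 !addr0.
Qed.

(** dE gains df /\ F + f dF + dg /\ B + g dB. The terms with df and dg die against F and B, and the
    others by the conditions on dF and dB. *)
Lemma closed_ideal3_shift (Y : set 'rV[R]_n) E F B f g :
  (forall y, Y y -> [/\ form_derivable E y, form_derivable F y & form_derivable B y]) ->
  (forall y, Y y -> forall a, cderivable f y a /\ cderivable g y a) ->
  closed_ideal3 Y E F B ->
  closed_ideal3 Y (fun y => E y + (f y *: F y + g y *: B y)) F B.
Proof.
move=> dEFB dfg /closed_ideal3P H; apply/closed_ideal3P => y Yy I.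
have [eF eB eE] := H y Yy I; have [dE dF dB] := dEFB y Yy.
have df a : cderivable f y a by have [] := dfg y Yy a.
have dg a : cderivable g y a by have [] := dfg y Yy a.
have shift w : (forall a b, w (pairi b a) = - w (pairi a b)) ->
    wedge3 (E y) (F y) (B y) I w = 0 ->
    wedge3 (E y + (f y *: F y + g y *: B y)) (F y) (B y) I w = 0.
  by move=> walt <-; exact: wedge3_E_shift.
split; first exact: shift (d1_anti F y) eF.
  exact: shift (d1_anti B y) eB.
apply: shift (d1_anti _ y) _.
have -> : d1 (fun y => E y + (f y *: F y + g y *: B y)) y = fun J =>
    d1 E y J + (wedge11 (d0 f y) (F y) J + f y * d1 F y J
                + (wedge11 (d0 g y) (B y) J + g y * d1 B y J)).
  apply/funext => J.
  have dfF := form_derivableZ df dF; have dgB := form_derivableZ dg dB.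
  rewrite (d1D _ dE (form_derivableD dfF dgB)) (d1D _ dfF dgB).
  by rewrite (d1Z _ df dF) (d1Z _ dg dB).
rewrite wedge3D eE add0r !wedge3D !wedge3Z eF eB !mulr0 !addr0.
rewrite -!/(wedge5 _ _ _ _ _ _).
by rewrite wedge5_F wedge5_B addr0.
Qed.

End ClosedIdeal.

Section LeviCivitaCore.
Variables (R : realType) (V : set 'rV[R]_4) (th : 'rV[R]_4 -> 'M[R[i]]_4).
Variable Gam : 'I_4 -> 'I_4 -> 'rV[R]_4 -> 'rV[R[i]]_4.
Hypotheses (openV : open V) (sth : csmooth_mx V th).
Hypothesis uth : forall u, V u -> th u \in unitmx.
Hypothesis lc : levi_civita V (fun=> null_gram R) th Gam.

Lemma closed_ideal3_levi_civita :
  closed_ideal3 (Defs.patch V) (twistor_E Gam) (twistor_F th) (twistor_B th) <->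
  (forall u i j, V u ->
     asd_2form (th u) (weyl_2form (fun=> null_gram R) th Gam u i j)).
Proof.
pose L u := riemann (fun=> null_gram R) th Gam u.
have quartic u : V u -> (forall i j,
    asd_2form (th u) (weyl_2form (fun=> null_gram R) th Gam u i j)) <->
    [/\ psi0 (L u) = 0, psi1 (L u) = 0, psi2 (L u) = 0, psi3 (L u) = 0 & psi4 (L u) = 0].
  move=> Vu.
  have La1 := riemann_anti1 openV lc Vu.
  have La2 := @riemann_anti2 R th Gam u.
  have Lb := riemann_bianchi openV sth uth lc Vu.
  have P := asd_componentsP La1 La2 Lb.
  have Q i j := asd_weyl_2formP Gam uth Vu i j.
  by split=> [H|/P H i j]; [apply/P => i j; apply/Q|apply/Q].
split=> [/closed_ideal3P closed u i j Vu|asd].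
  move: i j; apply/quartic => //.
  suff [] : [/\ psi0 (L u) = 0, psi1 (L u) = 0, psi2 (L u) = 0, - psi3 (L u) = 0
      & psi4 (L u) = 0].
    by move=> -> -> -> /eqP; rewrite oppr_eq0 => /eqP -> ->.
  apply: quartic_eq0 => z.
  (* The point over u with fibre coordinate z, where z is an arbitrary complex number. *)
  pose y : 'rV[R]_(4 + 2) := row_mx u
    (\row_(c < 2) if c == 0 then complex.Re z else complex.Im z).
  have yu : lsubmx y = u by rewrite row_mxKl.
  have yz : fibre_coord y = z.
    by rewrite /fibre_coord row_mxKr !mxE /=; case: (z).
  have Yy : Defs.patch V y by rewrite /Defs.patch /= yu.
  (* On these columns the factor multiplying the quartic is nonzero, so the quartic itself vanishes
     at z. *)
  have [_ _] := closed y Yy twistor_columns.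
  rewrite (wedge3_d1_twistor_E openV uth lc Yy) yu yz => /eqP.
  rewrite !mulf_eq0 oppr_eq0 pnatr_eq0 /= => /orP[/eqP->//|].
  by have /negbTE := @wedge5_twistor_neq0 R th Gam y (uth Yy); rewrite yu => ->.
apply/closed_ideal3P => y Yy I; split.
- exact: (wedge3_d1_twistor_F sth lc Yy I).
- exact: (wedge3_d1_twistor_B sth lc Yy I).
rewrite (wedge3_d1_twistor_E openV uth lc Yy).
have /quartic[//|-> -> -> -> ->] : forall i j, asd_2form (th (lsubmx y))
   (weyl_2form (fun=> null_gram R) th Gam (lsubmx y) i j) by move=> i j; exact: asd.
by rewrite !(mulr0, oppr0, addr0) mul0r.
Qed.

End LeviCivitaCore.

(** * Change of the Weyl form *)

Section ShiftAlgebra.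
Variables (C : numFieldType) (a : 'I_4 -> C).
Implicit Types (t : 'I_4 -> C) (b : C).

(** The difference tensor evaluated on one tangent vector X: t l = theta^l(X), b = A(X), and a holds
    the frame components of A. *)
Definition shift4 t b (i j : 'I_4) : C :=
  2^-1 * ((i == j)%:R * b + a j * t i
    - (4 * \sum_m gram4 C i m * a m) * \sum_l gram4 C j l * t l).

Lemma shift4_metric t b i j :
  \sum_k gram4 C i k * shift4 t b k j + \sum_k gram4 C j k * shift4 t b k i =
  gram4 C i j * b.
Proof.
rewrite !sum4 /shift4 !sum4.
by case: (ord4P i) => ->; case: (ord4P j) => ->; rewrite /gram4 /=; field.
Qed.

(** With A = A_k theta^k the terms A /\ theta^i and theta^i /\ A cancel, and the last term contracts
    the symmetric metric with theta^l /\ theta^j. *)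
Lemma shift4_torsion t t' i :
  \sum_j (shift4 t (\sum_k a k * t k) i j * t' j
          - shift4 t' (\sum_k a k * t' k) i j * t j) = 0.
Proof.
rewrite !sum4 /shift4 !sum4.
by case: (ord4P i) => ->; rewrite /gram4 /=; field.
Qed.

(** The multiples of A itself cancel between the entries (1,1) and (4,4); the remainder regroups
    into F and B. *)
Lemma shift4_twistor t b (z : C) :
  - shift4 t b i3 i2 + z * (shift4 t b i1 i1 - shift4 t b i4 i4)
  + z ^+ 2 * shift4 t b i2 i3 =
  2^-1 * (z * a i1 - a i4) * (t i1 + z * t i4)
  + 2^-1 * (z * a i3 - a i2) * (t i3 + z * t i2).
Proof. by rewrite /shift4 !sum4 /gram4 /=; field. Qed.

End ShiftAlgebra.

Lemma wedge11Dl (R : realType) (n : nat) (a b c : 'rV[R[i]]_n) I :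
  wedge11 (a + b) c I = wedge11 a c I + wedge11 b c I.
Proof. by rewrite !wedge11E !mxE; ring. Qed.

Lemma metric_equation_shift (F : fieldType) (n : nat) (d a0 a : 'rV[F]_n)
    (p q : 'I_4 -> F) (X Y X' Y' : 'I_4 -> 'rV[F]_n) (h : F) :
  d - \sum_k p k *: X k - \sum_k q k *: Y k = - (h *: a0) ->
  (forall c, \sum_k p k * X' k 0 c + \sum_k q k * Y' k 0 c = h * a 0 c) ->
  d - \sum_k p k *: (X k + X' k) - \sum_k q k *: (Y k + Y' k) = - (h *: (a0 + a)).
Proof.
move=> e e'; have -> : h *: (a0 + a) =
    h *: a0 + (\sum_k p k *: X' k + \sum_k q k *: Y' k).
  rewrite scalerDr; congr (_ + _); apply/rowP => c; rewrite !mxE -e' !summxE.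
  by congr (_ + _); apply: eq_bigr => k _; rewrite mxE.
rewrite opprD -e.
under [in LHS]eq_bigr do rewrite scalerDr.
under [X in _ - _ - X = _]eq_bigr do rewrite scalerDr.
by rewrite !big_split /= !opprD !addrA; congr (_ - _); rewrite addrAC.
Qed.

Lemma twistor_form_add (F : fieldType) (n : nat) (d : 'rV[F]_n) (z : F)
    (p32 p11 p44 p23 s32 s11 s44 s23 q32 q11 q44 q23 : 'rV[F]_n) :
  q32 = p32 + s32 -> q11 = p11 + s11 -> q44 = p44 + s44 -> q23 = p23 + s23 ->
  d - q32 + z *: (q11 - q44) + z ^+ 2 *: q23 =
  d - p32 + z *: (p11 - p44) + z ^+ 2 *: p23
  + (- s32 + z *: (s11 - s44) + z ^+ 2 *: s23).
Proof. by move=> -> -> -> ->; apply/rowP => c; rewrite !mxE; ring. Qed.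

Lemma twistor_form_eq (F : fieldType) (n : nat) (z x x' : F)
    (s32 s11 s44 s23 t1 t2 t3 t4 : 'rV[F]_n) (v32 v11 v44 v23 w1 w2 w3 w4 : 'I_n -> F) :
  s32 0 =1 v32 -> s11 0 =1 v11 -> s44 0 =1 v44 -> s23 0 =1 v23 ->
  t1 0 =1 w1 -> t2 0 =1 w2 -> t3 0 =1 w3 -> t4 0 =1 w4 ->
  (forall c, - v32 c + z * (v11 c - v44 c) + z ^+ 2 * v23 c =
     x * (w1 c + z * w4 c) + x' * (w3 c + z * w2 c)) ->
  - s32 + z *: (s11 - s44) + z ^+ 2 *: s23 =
  x *: (t1 + z *: t4) + x' *: (t3 + z *: t2).
Proof.
move=> e1 e2 e3 e4 f1 f2 f3 f4 e; apply/rowP => c.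
by rewrite !mxE e1 e2 e3 e4 f1 f2 f3 f4 e.
Qed.

Section WeylShift.
Variables (R : realType) (V : set 'rV[R]_4) (th : 'rV[R]_4 -> 'M[R[i]]_4).
Variable A : 'rV[R]_4 -> 'rV[R[i]]_4.
Hypotheses (openV : open V) (sth : csmooth_mx V th) (sA : csmooth_mx V A).
Hypothesis uth : forall u, V u -> th u \in unitmx.

Definition coframe_comp u (j : 'I_4) : R[i] := (A u *m invmx (th u)) 0 j.

(* 1/2 (delta^i_j A + A_j theta^i - A^i theta_j), the difference of the Weyl
   connections of (g, A0 + A) and (g, A0); 4 null_gram is the inverse metric. *)
Definition weyl_shift (i j : 'I_4) (u : 'rV[R]_4) : 'rV[R[i]]_4 :=
  2^-1 *: ((i == j)%:R *: A u + coframe_comp u j *: row i (th u)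
    - (4 * \sum_m null_gram R i m * coframe_comp u m)
        *: \sum_l null_gram R j l *: row l (th u)).

Lemma csmooth_coframe_comp j : csmooth V (fun u => coframe_comp u j).
Proof.
apply: (csmooth_ext openV (f := fun u => \sum_a A u 0 a * invmx (th u) a j)).
  by move=> u _; rewrite /coframe_comp mxE.
apply: (csmooth_sum openV) => a _; apply: (csmoothM openV); first exact: sA.
exact: (csmooth_invmx openV uth sth).
Qed.

Let weyl_shift_entry i j u c : weyl_shift i j u 0 c =
  shift4 (coframe_comp u) (fun l => th u l c) (A u 0 c) i j.
Proof.
rewrite /weyl_shift !mxE summxE; congr (_ * (_ - 4 * _ * _)).
  by apply: eq_bigr => m _; rewrite null_gramE.
by apply: eq_bigr => l _; rewrite mxE null_gramE mxE.
Qed.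

Lemma csmooth_weyl_shift i j : csmooth_mx V (weyl_shift i j).
Proof.
move=> a c; rewrite (ord1 a).
apply: (csmooth_ext openV) (fun u _ => esym (weyl_shift_entry i j u c)) _.
have sc := csmooth_cst openV.
have sa := csmooth_coframe_comp.
apply: (csmoothM openV) (sc _) _; apply: (csmoothB openV).
  apply: (csmoothD openV); first exact: (csmoothM openV (sc _) (sA _ _)).
  exact: (csmoothM openV (sa _) (sth _ _)).
apply: (csmoothM openV).
  apply: (csmoothM openV) (sc _) _; apply: (csmooth_sum openV) => m _.
  exact: (csmoothM openV (sc _) (sa _)).
apply: (csmooth_sum openV) => l _.
exact: (csmoothM openV (sc _) (sth _ _)).
Qed.

Let weyl_shift_metric u i j c :
  \sum_k null_gram R i k * weyl_shift k j u 0 c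
  + \sum_k null_gram R j k * weyl_shift k i u 0 c = null_gram R i j * A u 0 c.
Proof.
rewrite null_gramE -(shift4_metric (coframe_comp u) (fun l => th u l c)).
by congr (_ + _); apply: eq_bigr => k _; rewrite null_gramE weyl_shift_entry.
Qed.

Let weyl_shift_torsion u i I : V u ->
  \sum_j wedge11 (weyl_shift i j u) (row j (th u)) I = 0.
Proof.
move=> Vu.
have AE c : A u 0 c = \sum_j coframe_comp u j * th u j c.
  by rewrite -[in LHS](mulmxKV (uth Vu) (A u)) mxE.
have e := shift4_torsion (coframe_comp u) (fun l => th u l (I 0))
  (fun l => th u l (I 1)) i.
rewrite -[RHS]e; apply: eq_bigr => j _.
by rewrite wedge11E !weyl_shift_entry !AE !mxE.
Qed.

Variable A0 : 'rV[R]_4 -> 'rV[R[i]]_4.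
Variable Gam : 'I_4 -> 'I_4 -> 'rV[R]_4 -> 'rV[R[i]]_4.
Hypothesis wc : weyl_connection V (fun=> null_gram R) A0 th Gam.

Let Gam' i j u := Gam i j u + weyl_shift i j u.

Lemma weyl_connection_shift :
  weyl_connection V (fun=> null_gram R) (fun u => A0 u + A u) th Gam'.
Proof.
have [sG metricG torsionG] := wc; split.
- move=> i j a c.
  apply: (csmooth_ext openV) (fun u _ => esym (mxE _ _ _ _)) _.
  exact: (csmoothD openV (sG _ _ _ _) (csmooth_weyl_shift _ _ _ _)).
- move=> u i j Vu; apply: metric_equation_shift (metricG u i j Vu) _.
  exact: weyl_shift_metric.
move=> u i I Vu; rewrite torsionG // -[LHS]subr0 -[X in _ - X](weyl_shift_torsion i I Vu).
rewrite -opprD -big_split; congr (- _); apply: eq_bigr => j _.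
by rewrite /= wedge11Dl.
Qed.

Lemma twistor_E_shift y : twistor_E Gam' y = twistor_E Gam y +
  ((2^-1 * (fibre_coord y * coframe_comp (lsubmx y) i1 - coframe_comp (lsubmx y) i4))
     *: twistor_F th y +
   (2^-1 * (fibre_coord y * coframe_comp (lsubmx y) i3 - coframe_comp (lsubmx y) i2))
     *: twistor_B th y).
Proof.
pose S i j := pullback (weyl_shift i j) y.
have G'E i j : pullback (Gam' i j) y = pullback (Gam i j) y + S i j.
  by rewrite /S /pullback add_row_mx addr0.
apply: etrans (twistor_form_add _ _ (G'E i3 i2) (G'E i1 i1) (G'E i4 i4) (G'E i2 i3)) _.
apply: congr1.
have SE i j (c : 'I_(4 + 2)) : S i j 0 c = if fintype.split c is inl d
    then shift4 (coframe_comp (lsubmx y)) (fun l => th (lsubmx y) l d)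
           (A (lsubmx y) 0 d) i j
    else 0.
  by rewrite /S /pullback mxE; case: fintype.split => d; rewrite ?weyl_shift_entry ?mxE.
have TE k (c : 'I_(4 + 2)) : pullback (fun u => row k (th u)) y 0 c =
    if fintype.split c is inl d then th (lsubmx y) k d else 0.
  by rewrite /pullback mxE; case: fintype.split => d; rewrite mxE.
apply: (twistor_form_eq (SE i3 i2) (SE i1 i1) (SE i4 i4) (SE i2 i3)
  (TE i1) (TE i2) (TE i3) (TE i4)) => c.
case: (fintype.split c) => d; first exact: shift4_twistor.
by rewrite !(mulr0, subrr, oppr0, addr0).
Qed.

Lemma closed_ideal3_weyl_shift :
  closed_ideal3 (Defs.patch V) (twistor_E Gam) (twistor_F th) (twistor_B th) ->
  closed_ideal3 (Defs.patch V) (twistor_E Gam') (twistor_F th) (twistor_B th).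
Proof.
rewrite (funext twistor_E_shift); apply: closed_ideal3_shift => y Yy;
  have Vy : V (lsubmx y) := Yy.
  have sG i j : form_derivable (pullback (Gam i j)) y.
    apply: form_derivable_pullback => c a; have [sG _ _] := wc.
    by apply: csmooth_cderivable Vy _; exact: sG.
  have st k : form_derivable (pullback (fun u => row k (th u))) y.
    apply: form_derivable_pullback => c a.
    apply: csmooth_cderivable Vy _; apply: (csmooth_ext openV) (sth k c) => v _.
    by rewrite mxE.
  have df a : cderivable (@fibre_coord R) y a by exact: cderivable_fibre_coord.
  have df2 a : cderivable (fun v => @fibre_coord R v ^+ 2) y a.
    rewrite (_ : (fun v => _) = fun v => fibre_coord v * fibre_coord v) //.
    exact: cderivableM (df a) (df a).
  split.
  - apply: form_derivableD; last exact: form_derivableZ df2 (sG _ _).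
    apply: form_derivableD.
      exact: form_derivableD (@form_derivable_dfibre R y) (form_derivableN (sG _ _)).
    exact: form_derivableZ df (form_derivableD (sG _ _) (form_derivableN (sG _ _))).
  - exact: form_derivableD (st _) (form_derivableZ df (st _)).
  - exact: form_derivableD (st _) (form_derivableZ df (st _)).
have da j a : cderivable (fun v => coframe_comp (lsubmx v) j) y a.
  apply: (cderivable_pullback (f := fun u => coframe_comp u j)) => b.
  exact: csmooth_cderivable Vy (csmooth_coframe_comp j).
move=> a.
have H j k : cderivable (fun v => 2^-1 *
    (fibre_coord v * coframe_comp (lsubmx v) j - coframe_comp (lsubmx v) k)) y a.
  apply: cderivableM; first exact: cderivable_cst.
  apply: cderivableD; last exact: cderivableN (da k a).
  exact: cderivableM (cderivable_fibre_coord y a) (da j a).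
exact: conj (H i1 i4) (H i3 i2).
Qed.

End WeylShift.

(** * Exchange of the two orientations *)

(** Makes the shifts by A and by -A inverse to each other. *)
Lemma weyl_shiftN (R : realType) (th : 'rV[R]_4 -> 'M[R[i]]_4)
    (A : 'rV[R]_4 -> 'rV[R[i]]_4) i j u :
  weyl_shift th (fun v => - A v) i j u = - weyl_shift th A i j u.
Proof.
have compN k : coframe_comp th (fun v => - A v) u k = - coframe_comp th A u k.
  by rewrite /coframe_comp mulNmx [LHS]mxE.
rewrite /weyl_shift; under eq_bigr do rewrite compN mulrN.
rewrite compN sumrN mulrN !scaleNr -[RHS]scalerN; congr (_ *: _).
by rewrite scalerN !opprD !opprK.
Qed.

Section WeylCore.
Variables (R : realType) (V : set 'rV[R]_4) (th : 'rV[R]_4 -> 'M[R[i]]_4).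
Variable A : 'rV[R]_4 -> 'rV[R[i]]_4.
Hypotheses (openV : open V) (sth : csmooth_mx V th) (sA : csmooth_mx V A).
Hypothesis uth : forall u, V u -> th u \in unitmx.

Let csmooth_oppA : csmooth_mx V (fun u => - A u).
Proof.
move=> a c; apply: (csmooth_ext openV) (csmoothN openV (sA a c)) => u _.
by rewrite mxE.
Qed.

(** Anti-self-duality concerns Levi-Civita connections and closedness concerns Weyl connections;
    shifting by A or -A exchanges the two classes and preserves closedness. *)
Lemma asd_iff_closed_ideal3 :
  (forall Gam, levi_civita V (fun=> null_gram R) th Gam -> forall u i j, V u ->
     asd_2form (th u) (weyl_2form (fun=> null_gram R) th Gam u i j)) <->
  (forall Gam, weyl_connection V (fun=> null_gram R) A th Gam ->
     closed_ideal3 (Defs.patch V) (twistor_E Gam) (twistor_F th) (twistor_B th)).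
Proof.
have shiftK (X X' : 'I_4 -> 'I_4 -> 'rV[R]_4 -> 'rV[R[i]]_4) Gam :
    (forall i j u, X i j u + X' i j u = 0) ->
    (fun i j u => Gam i j u + X i j u + X' i j u) = Gam.
  move=> XX'; apply/funext => i; apply/funext => j; apply/funext => u.
  by rewrite -addrA XX' addr0.
split=> [asd Gam wc|closed Gam lc].
  (* The shift by -A reaches a Levi-Civita connection, where closedness is known; the shift by A
     carries it back, and [shiftK] recognises the original connection. *)
  have lc := weyl_connection_shift openV sth csmooth_oppA uth wc.
  have {}lc : levi_civita V (fun=> null_gram R) th
      (fun i j u => Gam i j u + weyl_shift th (fun v => - A v) i j u).
    by move: lc; congr weyl_connection; apply/funext => u; rewrite subrr.
  have := closed_ideal3_weyl_shift openV sth sA uth lc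
    (iffRL (closed_ideal3_levi_civita openV sth uth lc) (asd _ lc)).
  by rewrite shiftK // => i j u; rewrite weyl_shiftN addNr.
have wc := weyl_connection_shift openV sth sA uth lc.
have {}wc : weyl_connection V (fun=> null_gram R) A th
    (fun i j u => Gam i j u + weyl_shift th A i j u).
  by move: wc; congr weyl_connection; apply/funext => u; rewrite add0r.
apply/(closed_ideal3_levi_civita openV sth uth lc).
have := closed_ideal3_weyl_shift openV sth csmooth_oppA uth wc (closed _ wc).
by rewrite shiftK // => i j u; rewrite weyl_shiftN addrN.
Qed.

End WeylCore.

(** Exchanging M and P preserves MP - NK and sends P /\ K, N /\ K - M /\ P, N /\ M to M /\ K, N /\ K
    + M /\ P, N /\ P. *)
Definition swap12 (k : 'I_4) : 'I_4 :=
  if k == i1 then i2 else if k == i2 then i1 else k.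

Lemma swap12K : involutive swap12.
Proof. by move=> k; case: (ord4P k) => ->. Qed.

Lemma sum_swap12 (U : nmodType) (F : 'I_4 -> U) : \sum_k F (swap12 k) = \sum_k F k.
Proof. by rewrite [RHS](reindex_inj (inv_inj swap12K)). Qed.

Lemma null_gram_swap12 (R : realType) i j :
  null_gram R (swap12 i) (swap12 j) = null_gram R i j.
Proof.
by rewrite !null_gramE; case: (ord4P i) => ->; case: (ord4P j) => ->.
Qed.

Definition swap_coframe (R : realType) (th : 'rV[R]_4 -> 'M[R[i]]_4) u : 'M[R[i]]_4 :=
  \matrix_(i, j) th u (swap12 i) j.

Definition swap_connection (R : realType)
  (Gam : 'I_4 -> 'I_4 -> 'rV[R]_4 -> 'rV[R[i]]_4) (i j : 'I_4) :=
  Gam (swap12 i) (swap12 j).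

Section Swap.
Variables (R : realType) (V : set 'rV[R]_4) (th : 'rV[R]_4 -> 'M[R[i]]_4).
Hypothesis openV : open V.

Lemma swap_coframeK : swap_coframe (swap_coframe th) = th.
Proof. by apply/funext => u; apply/matrixP => i j; rewrite !mxE swap12K. Qed.

Lemma row_swap_coframe u k : row k (swap_coframe th u) = row (swap12 k) (th u).
Proof. by apply/rowP => c; rewrite !mxE. Qed.

Lemma csmooth_swap_coframe : csmooth_mx V th -> csmooth_mx V (swap_coframe th).
Proof.
move=> sth i j; apply: (csmooth_ext openV) (sth (swap12 i) j) => u _.
by rewrite mxE.
Qed.

Let swap_coframe_invE u : th u \in unitmx ->
  swap_coframe th u *m (\matrix_(a, k) invmx (th u) a (swap12 k)) = 1%:M.
Proof.
move=> ut; apply/matrixP => i k; rewrite !mxE.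
have /matrixP/(_ (swap12 i) (swap12 k)) := mulmxV ut; rewrite !mxE.
rewrite (inj_eq (inv_inj swap12K)) => <-.
by apply: eq_bigr => a _; rewrite !mxE.
Qed.

Lemma unitmx_swap_coframe u : th u \in unitmx -> swap_coframe th u \in unitmx.
Proof. by move=> /swap_coframe_invE/mulmx1_unit[]. Qed.

Lemma invmx_swap_coframe u a k : th u \in unitmx ->
  invmx (swap_coframe th u) a k = invmx (th u) a (swap12 k).
Proof.
move=> ut; have e := swap_coframe_invE ut; have us := unitmx_swap_coframe ut.
have -> : invmx (swap_coframe th u) = \matrix_(a, k) invmx (th u) a (swap12 k).
  by rewrite -[LHS]mulmx1 -e mulmxA mulVmx // mul1mx.
by rewrite mxE.
Qed.

Variable Gam : 'I_4 -> 'I_4 -> 'rV[R]_4 -> 'rV[R[i]]_4.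

Lemma swap_connectionK : swap_connection (swap_connection Gam) = Gam.
Proof.
apply/funext => i; apply/funext => j.
by rewrite /swap_connection !swap12K.
Qed.

Lemma weyl_connection_swap A :
  weyl_connection V (fun=> null_gram R) A th Gam ->
  weyl_connection V (fun=> null_gram R) A (swap_coframe th) (swap_connection Gam).
Proof.
move=> [sG metricG torsionG]; split=> [i j|u i j Vu|u i I Vu].
- exact: sG.
- have := metricG u (swap12 i) (swap12 j) Vu.
  rewrite -(sum_swap12 (fun k => _ *: Gam k (swap12 j) u)).
  rewrite -(sum_swap12 (fun k => _ *: Gam k (swap12 i) u)) null_gram_swap12.
  under [in X in X -> _]eq_bigr do rewrite null_gram_swap12.
  under [X in _ - X = _ -> _]eq_bigr do rewrite null_gram_swap12.
  by [].
have := torsionG u (swap12 i) I Vu.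
rewrite -(sum_swap12 (fun j => wedge11 (Gam (swap12 i) j u) _ I)).
have -> : (fun v => row i (swap_coframe th v)) = (fun v => row (swap12 i) (th v)).
  by apply/funext => v; rewrite row_swap_coframe.
by move=> ->; congr (- _); apply: eq_bigr => j _; rewrite row_swap_coframe.
Qed.

Lemma curvature_form_swap u i j : curvature_form (swap_connection Gam) i j u =
  curvature_form Gam (swap12 i) (swap12 j) u.
Proof.
apply/funext => I; congr (_ + _).
exact: (sum_swap12 (fun k => wedge11 (Gam (swap12 i) k u) (Gam k (swap12 j) u) I)).
Qed.

Variable u : 'rV[R]_4.
Hypothesis ut : th u \in unitmx.

Let riemann_up_swap i j k l :
  riemann_up (swap_coframe th) (swap_connection Gam) u i j k l =
  riemann_up th Gam u (swap12 i) (swap12 j) (swap12 k) (swap12 l).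
Proof.
rewrite /riemann_up curvature_form_swap.
by apply: eq_bigr => a _; apply: eq_bigr => b _; rewrite !invmx_swap_coframe.
Qed.

Let ricci_swap j l : ricci (swap_coframe th) (swap_connection Gam) u j l =
  ricci th Gam u (swap12 j) (swap12 l).
Proof.
rewrite /ricci; under eq_bigr do rewrite riemann_up_swap.
exact: (sum_swap12 (fun k => riemann_up th Gam u k (swap12 j) k (swap12 l))).
Qed.

Let scalar_swap :
  scalar_curvature (fun=> null_gram R) (swap_coframe th) (swap_connection Gam) u =
  scalar_curvature (fun=> null_gram R) th Gam u.
Proof.
rewrite /scalar_curvature -[RHS]sum_swap12; apply: eq_bigr => j _.
rewrite -[RHS]sum_swap12; apply: eq_bigr => l _.
rewrite ricci_swap; congr (_ * _).
have invE a b : invmx (null_gram R) a b = 4 * null_gram R a b.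
  by rewrite invmx_null_gram mxE.
by rewrite !invE null_gram_swap12.
Qed.

Lemma weyl_tensor_swap i j k l :
  weyl_tensor (fun=> null_gram R) (swap_coframe th) (swap_connection Gam) u i j k l =
  weyl_tensor (fun=> null_gram R) th Gam u (swap12 i) (swap12 j) (swap12 k) (swap12 l).
Proof.
rewrite /weyl_tensor scalar_swap !ricci_swap !null_gram_swap12; congr (_ - _ + _).
rewrite /riemann -[RHS]sum_swap12; apply: eq_bigr => m _.
by rewrite riemann_up_swap null_gram_swap12.
Qed.

Lemma weyl_2form_swap i j :
  weyl_2form (fun=> null_gram R) (swap_coframe th) (swap_connection Gam) u i j =
  weyl_2form (fun=> null_gram R) th Gam u (swap12 i) (swap12 j).
Proof.
apply/funext => I; congr (_ * _); rewrite -[RHS]sum_swap12; apply: eq_bigr => k _.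
rewrite -[RHS]sum_swap12; apply: eq_bigr => l _.
by rewrite weyl_tensor_swap !row_swap_coframe.
Qed.

Lemma asd_2form_swap w : asd_2form (swap_coframe th u) w <-> sd_2form (th u) w.
Proof.
rewrite /asd_2form /sd_2form !row_swap_coframe /=.
by split=> -[a [b [c e]]]; exists a, b, c => I; rewrite e !wedge11E; ring.
Qed.

End Swap.

(** * From one coframe to the manifold *)

Lemma null_cotetrad_regular (R : realType) (X : oriented_manifold4 R)
    (G : weyl_geometry X) c V th : null_cotetrad G c V th ->
  [/\ open V, csmooth_mx V th, csmooth_mx V (weyl_form G c)
    & forall u, V u -> th u \in unitmx].
Proof.
move=> [openV Vim sth tetrad]; split=> // [i j|u Vu].
  have [sr si] := @weyl_form_smooth R X G c i j.
  by split=> k; [exact: Ck_sub Vim (sr k)|exact: Ck_sub Vim (si k)].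
(* The determinant of the coframe is the volume coefficient, whose square 16 det g is nonzero. *)
rewrite unitmxE unitfE; have [_ <-] := tetrad u Vu.
have := vol_norm G (Vim u Vu); have := metric_nondeg G (Vim u Vu).
move=> d0 v2; apply: contraNneq d0 => v0; move/eqP: v2.
by rewrite v0 expr0n eq_sym mulf_eq0 pnatr_eq0.
Qed.

Theorem theorem6p4 (R : realType) (X : oriented_manifold4 R)
    (G : weyl_geometry X) :
  (anti_self_dual G <-> closed_on_P G) /\
  (self_dual G <-> closed_on_P' G).
Proof.
split.
  have P c V th (nc : null_cotetrad G c V th) := let: And4 oV sV sA uV :=
    null_cotetrad_regular nc in asd_iff_closed_ideal3 oV sV sA uV.
  split=> H c V th Gam nc conn.
    by have [+ _] := P c V th nc; apply=> // Gam' lc; exact: H nc lc.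
  by have [_ +] := P c V th nc; apply=> // Gam' lc; exact: H nc lc.
(* The swap sends the connection forms 32, 11, 44, 23 of E to 31, 22, 44, 13, which are those of
   E'. *)
have swapE Gam : twistor_E (swap_connection Gam) = @twistor_E' R Gam by [].
have swapF th : twistor_F (swap_coframe th) = @twistor_F' R th.
  have E k : (fun u => row k (swap_coframe th u)) = fun u => row (swap12 k) (th u).
    by apply/funext => u; rewrite row_swap_coframe.
  by apply/funext => y; rewrite /twistor_F !E.
have swapB th : twistor_B (swap_coframe th) = @twistor_B' R th.
  have E k : (fun u => row k (swap_coframe th u)) = fun u => row (swap12 k) (th u).
    by apply/funext => u; rewrite row_swap_coframe.
  by apply/funext => y; rewrite /twistor_B !E.
split=> H c V th Gam nc conn; have [oV sV sA uV] := null_cotetrad_regular nc;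
  have us u : V u -> swap_coframe th u \in unitmx
    by move=> /uV; exact: unitmx_swap_coframe.
  have [+ _] := asd_iff_closed_ideal3 oV (csmooth_swap_coframe oV sV) sA us.
  rewrite -swapE -swapF -swapB; apply=> [Gam' lc u i j Vu|].
    (* A Levi-Civita connection of the swapped coframe is the swap of one of [th], to which
       self-duality applies. *)
    apply/asd_2form_swap; rewrite -(swap_connectionK Gam') weyl_2form_swap ?uV //.
    apply: H nc _ _ _ _ Vu; rewrite -(swap_coframeK th).
    exact: weyl_connection_swap.
  exact: weyl_connection_swap.
have [_ +] := asd_iff_closed_ideal3 oV (csmooth_swap_coframe oV sV) sA us.
move=> Q u i j Vu.
rewrite -(swap12K i) -(swap12K j) -(weyl_2form_swap _ (uV u Vu)); apply/asd_2form_swap.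
apply: Q Vu; last exact: weyl_connection_swap conn.
move=> Gam' wc; rewrite -(swap_connectionK Gam') swapE swapF swapB.
apply: H nc _; rewrite -(swap_coframeK th).
exact: weyl_connection_swap.
Qed.
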